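(* For every positive integer $k$, there exists an extremal Type~II $\mathbb{Z}_{2k}$-code of length $48$.
   Context: $\mathbb{Z}_m$ denotes the ring of integers modulo $m$. A $\mathbb{Z}_m$-code of length $n$ is a $\mathbb{Z}_m$-submodule of $\mathbb{Z}_m^n$; it is self-dual if $C=C^\perp$ with respect to the standard inner product. The Euclidean weight of $x=(x_1,\dots,x_n)\in\mathbb{Z}_m^n$ is $\sum_{\alpha=1}^{\lfloor m/2\rfloor} n_\alpha(x)\alpha^2$, where $n_\alpha(x)$ is the number of $i$ with $x_i\equiv\pm\alpha \pmod m$; $d_E(C)$ is the minimum Euclidean weight of a nonzero codeword. A Type~II $\mathbb{Z}_{2k}$-code is a self-dual $\mathbb{Z}_{2k}$-code all of whose codewords have Euclidean weight divisible by $4k$. For a Type~II $\mathbb{Z}_{2k}$-code $C$ of length $n\le 136$ one has $d_E(C)\le 4k\lfloor n/24\rfloor+4k$, and $C$ is called extremal if equality holds. *)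

(* Defs.v *)
From HB Require Import structures.
From mathcomp Require Import all_boot all_order all_algebra.
Set Implicit Arguments. Unset Strict Implicit. Unset Printing Implicit Defensive.
Import GRing.Theory.
Local Open Scope ring_scope.

(* Z_m-codes of length n: subsets of 'rV['Z_m]_n that are Z_m-submodules.
   ('Z_m is only meaningful for m >= 2.) *)

Definition is_code (m n : nat) (C : {set 'rV['Z_m]_n}) : Prop :=
  [/\ 0 \in C,
      (forall x y, x \in C -> y \in C -> x + y \in C) &
      (forall (a : 'Z_m) x, x \in C -> a *: x \in C)].

Definition inner (m n : nat) (x y : 'rV['Z_m]_n) : 'Z_m :=
  \sum_(i < n) x ord0 i * y ord0 i.

Definition dual_code (m n : nat) (C : {set 'rV['Z_m]_n}) : {set 'rV['Z_m]_n} :=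
  [set x | [forall y in C, inner x y == 0]].

Definition self_dual (m n : nat) (C : {set 'rV['Z_m]_n}) : Prop :=
  is_code C /\ C = dual_code C.

Definition n_alpha (m n : nat) (a : nat) (x : 'rV['Z_m]_n) : nat :=
  #|[set i : 'I_n | (x ord0 i == a%:R) || (x ord0 i == - a%:R)]|.

Definition euclid_wt (m n : nat) (x : 'rV['Z_m]_n) : nat :=
  (\sum_(1 <= a < (m./2).+1) n_alpha a x * a ^ 2)%N.

Definition min_euclid_wt (m n : nat) (C : {set 'rV['Z_m]_n}) (d : nat) : Prop :=
  (exists2 c, c \in C & (c != 0) && (euclid_wt c == d)) /\
  (forall c, c \in C -> c != 0 -> (d <= euclid_wt c)%N).

Definition typeII (k n : nat) (C : {set 'rV['Z_(2 * k)]_n}) : Prop :=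
  self_dual C /\ (forall c, c \in C -> (4 * k %| euclid_wt c)%N).

Definition extremal (k n : nat) (C : {set 'rV['Z_(2 * k)]_n}) : Prop :=
  min_euclid_wt C (4 * k * (n %/ 24) + 4 * k)%N.

(* Main.v *)
(* If an even unimodular lattice L of rank 48 and minimum norm 6 contains 48 pairwise orthogonal vectors f_i of norm 2k,
   then the x in (Z/2k)^48 such that sum_i x_i f_i / 2k lies in L form a Type II code; a codeword has Euclidean weight
   2k times the norm of a lattice vector, hence at least 12k, and the minimal vectors of L give weight 12k.

   For k > 2 we take L = P48p, an even neighbour of the odd lattice obtained from the Pless symmetry code
   {(y, yM)} over F_3, where M is the skew Paley matrix of order 24.  Minimum norm 6 comes from the minimum weight 15 of
   this code (an exhaustive search over one half, modulo the affine group of F_23) and from the fact that its words of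
   weight 48 are the 96 rows of +-H, H a Hadamard matrix (the code is an orthogonal array of strength 12, which determines
   the number of words of weight 48).  Signed permutations q1, q2, q3 behaving like the quaternion units commute with M,
   so the blocks A = 3a + cM and B = b + 3(d q1 + e q2 + f q3), with b = c mod 3, give a frame [A B; -B^T A^T] of norm
   3(a^2 + d^2 + e^2 + f^2) + (23c^2 + b^2)/3, and by Lagrange's theorem (c, b) = (0, 0), (1, 1), (1, 4) reach every
   2k > 4 except 10, for which an explicit frame is used.

   For k = 2 the other even neighbour of the same odd lattice has the rows of +-H as its only vectors of norm 4, and they
   form a frame.  For k = 1 the code is the extended binary quadratic residue code. *)
From HB Require Import structures.
Require Import Defs.
From mathcomp Require Import all_boot all_order all_algebra all_fingroup mxabelem.
From mathcomp Require Import zify ring ssrZ.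
Set Implicit Arguments. Unset Strict Implicit. Unset Printing Implicit Defensive.
Import Order.TTheory GRing.Theory Num.Theory.
Local Open Scope ring_scope.

(** * Integer vectors and reduction modulo m *)

Definition dot (R : pzRingType) n (u v : 'rV[R]_n) : R := (u *m v^T) 0 0.

Lemma dotE (R : pzRingType) n (u v : 'rV[R]_n) : dot u v = \sum_i u 0 i * v 0 i.
Proof. by rewrite /dot mxE; apply: eq_bigr => i _; rewrite mxE. Qed.

Lemma dotC (R : comPzRingType) n (u v : 'rV[R]_n) : dot u v = dot v u.
Proof. by rewrite !dotE; apply: eq_bigr => i _; rewrite mulrC. Qed.

Lemma dotDl (R : pzRingType) n (u v w : 'rV[R]_n) : dot (u + v) w = dot u w + dot v w.
Proof. by rewrite /dot mulmxDl mxE. Qed.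

Lemma dotZl (R : pzRingType) n a (u v : 'rV[R]_n) : dot (a *: u) v = a * dot u v.
Proof. by rewrite /dot -scalemxAl mxE. Qed.

Lemma dotBl (R : pzRingType) n (u v w : 'rV[R]_n) : dot (u - v) w = dot u w - dot v w.
Proof. by rewrite -scaleN1r dotDl dotZl mulN1r. Qed.

Lemma dot_rowl (R : pzRingType) m n (F : 'M[R]_(m, n)) (i : 'I_m) v :
  dot (row i F) v = (F *m v^T) i 0.
Proof. by rewrite /dot -row_mul mxE. Qed.

Lemma dot_rowr (R : comPzRingType) m n (F : 'M[R]_(m, n)) (i : 'I_m) v :
  dot v (row i F) = (v *m F^T) 0 i.
Proof. by rewrite dotC dot_rowl (_ : v *m F^T = (F *m v^T)^T) ?mxE // trmx_mul trmxK. Qed.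

Lemma dot_delta n (h : 'rV[int]_n) i : dot h (delta_mx 0 i) = h 0 i.
Proof. by rewrite dotC /dot -rowE !mxE. Qed.

Lemma dot_ge0 n (u : 'rV[int]_n) : 0 <= dot u u.
Proof. by rewrite dotE sumr_ge0 // => i _; rewrite -expr2 sqr_ge0. Qed.

Lemma dot_gt0 n (u : 'rV[int]_n) : u != 0 -> 0 < dot u u.
Proof.
move=> u0; rewrite lt_def dot_ge0 andbT; apply: contraNneq u0 => uu.
apply/eqP/rowP => i; rewrite mxE; move/eqP: uu.
rewrite dotE psumr_eq0 => [/allP /(_ i)|j _]; last by rewrite -expr2 sqr_ge0.
by rewrite mem_index_enum mulf_eq0 orbb => /(_ isT) /eqP.
Qed.

Lemma scale_row_inj (R : idomainType) n (a : R) : a != 0 -> injective ( *:%R a : 'rV[R]_n -> _).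
Proof.
move=> a0 u v uv; apply/rowP => i; apply: (mulfI a0).
by move/rowP: uv => /(_ i); rewrite !mxE.
Qed.

(** * Self-dual codes {(y, yP)} with P P^T = -1 *)

Section SelfDualCode.
Variables (R : comNzRingType) (n : nat) (P : 'M[R]_n).
Hypothesis PP : P *m P^T = - 1%:M.

Lemma dot_code_word y y' : dot (row_mx y (y *m P)) (row_mx y' (y' *m P)) = 0.
Proof.
rewrite /dot tr_row_mx mul_row_col trmx_mul mulmxA -[y *m _ *m _]mulmxA PP mulmxN mulmx1.
by rewrite mulNmx subrr mxE.
Qed.

Lemma code_word_dual (c : 'rV[R]_(n + n)) : (forall y, dot c (row_mx y (y *m P)) = 0) ->
  c = row_mx (lsubmx c) (lsubmx c *m P).
Proof.
move=> dual; rewrite -[LHS]hsubmxK; congr row_mx.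
have PtP : P^T *m P = - 1%:M.
  have : P *m - P^T = 1%:M by rewrite mulmxN PP opprK.
  by move/mulmx1C; rewrite mulNmx => /(congr1 -%R); rewrite opprK.
have e : lsubmx c + rsubmx c *m P^T = 0.
  apply/rowP => j; have := dual (delta_mx 0 j).
  rewrite /dot -[c in c *m _]hsubmxK tr_row_mx mul_row_col trmx_mul mulmxA -mulmxDl.
  by rewrite trmx_delta -colE !mxE.
have -> : lsubmx c = - (rsubmx c *m P^T) by apply/eqP; rewrite -addr_eq0 e.
by rewrite mulNmx -mulmxA PtP mulmxN mulmx1 opprK.
Qed.
End SelfDualCode.

Lemma dvd_rowP (d : int) n (v : 'rV[int]_n) :
  (forall i, (d %| v 0%R i)%Z) -> v = d *: map_mx (divz^~ d) v.
Proof. by move=> dv; apply/rowP => i; rewrite !mxE mulrC divzK. Qed.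

(** As c need not be invertible over the integers, the one-sided inverse is made two-sided over the
    rationals. *)
Lemma mul_tr_scalarC n (F : 'M[int]_n) (c : int) : c != 0 -> F *m F^T = c%:M -> F^T *m F = c%:M.
Proof.
move=> c0 FF; pose Q := map_mx intr : 'M[int]_n -> 'M[rat]_n.
have cQ : c%:~R != 0 :> rat by rewrite intr_eq0.
have : Q F *m (c%:~R^-1 *: Q F^T) = 1%:M.
  by rewrite -scalemxAr -map_mxM FF map_scalar_mx scale_scalar_mx mulVf.
move/mulmx1C; rewrite -scalemxAl -map_mxM => /(congr1 ( *:%R c%:~R)).
rewrite scalerA divff // scale1r scale_scalar_mx mulr1 => FQ.
apply/matrixP => i j; apply: (@intr_inj rat); move/matrixP: FQ => /(_ i j).
by rewrite !mxE rmorphMn.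
Qed.

Section Reduction.
Variables (m n : nat).
Hypothesis m_gt1 : (1 < m)%N.
Implicit Types (x y : 'rV['Z_m]_n) (u v : 'rV[int]_n).

Lemma natr_Zp_eq0 (a : nat) : ((a%:R : 'Z_m) == 0) = (m %| a)%N.
Proof. by rewrite -val_eqE /= val_Zp_nat. Qed.

Lemma intr_Zp_eq0 (z : int) : ((z%:~R : 'Z_m) == 0) = (m %| z)%Z.
Proof.
rewrite dvdzE /= -natr_Zp_eq0.
by case: z => a //=; rewrite NegzE mulrNz oppr_eq0.
Qed.

Lemma intr_Zp_eq (y z : int) : ((y%:~R : 'Z_m) == z%:~R) = (m %| y - z)%Z.
Proof. by rewrite -subr_eq0 -intrB intr_Zp_eq0. Qed.

Definition redm u : 'rV['Z_m]_n := map_mx intr u.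
Definition liftm x : 'rV[int]_n := \row_i (nat_of_ord (x 0 i))%:Z.

Lemma liftmK x : redm (liftm x) = x.
Proof. by apply/rowP => i; rewrite !mxE -[LHS]/((x 0 i : nat)%:R) natr_Zp. Qed.

Lemma redm_eqP u v : redm u = redm v <-> exists t, u = v + m%:Z *: t.
Proof.
split=> [uv|[t ->]]; last first.
  apply/rowP => i; rewrite !mxE; apply/eqP; rewrite intr_Zp_eq.
  by rewrite addrAC subrr add0r dvdz_mulr.
exists (map_mx (divz^~ m%:Z) (u - v)); rewrite -dvd_rowP ?subrKC // => i.
by rewrite -intr_Zp_eq0; move/rowP: uv => /(_ i); rewrite !mxE intrB => ->; rewrite subrr.
Qed.

Lemma redmD u v : redm (u + v) = redm u + redm v.
Proof. exact: map_mxD. Qed.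

Lemma redm_eq0 u : (redm u == 0) = [forall i, (m %| u 0%R i)%Z].
Proof.
apply/eqP/forallP => [u0 i|u0].
  by rewrite -intr_Zp_eq0; move/rowP: u0 => /(_ i); rewrite !mxE => ->.
by apply/rowP => i; rewrite !mxE; apply/eqP; rewrite intr_Zp_eq0.
Qed.

Lemma inner_redm u v : (inner (redm u) (redm v) == 0) = (m %| dot u v)%Z.
Proof.
rewrite -intr_Zp_eq0 dotE rmorph_sum; congr (_ == _).
by apply: eq_bigr => i _; rewrite !mxE rmorphM.
Qed.

End Reduction.

(** * Euclidean weight as the norm of the centered lift *)

Section EuclideanWeight.
Variables (k n : nat).
Hypothesis k_gt0 : (0 < k)%N.
Let m := (2 * k)%N.
Let m_gt1 : (1 < m)%N. Proof. by rewrite /m; lia. Qed.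

(** The representative in (-k, k], of least absolute value in its class. *)
Definition center (a : 'Z_m) : int := if (a <= k)%N then a%:Z else a%:Z - m%:Z.
Definition centerm (x : 'rV['Z_m]_n) : 'rV[int]_n := \row_i center (x 0 i).

Lemma ltn_Zm (a : 'Z_m) : (a < m)%N.
Proof. by rewrite -[X in (_ < X)%N](Zp_cast m_gt1) ltn_ord. Qed.

Lemma center_bound a : `|center a| <= k%:Z.
Proof. by have am := ltn_Zm a; rewrite /center; case: (leqP a k); move: am; rewrite /m; lia. Qed.

Lemma centerK a : (center a)%:~R = a.
Proof.
rewrite /center; case: leqP => _; rewrite ?intrB.
  by rewrite -[LHS]/((a : nat)%:R) natr_Zp.
by rewrite -![_%:~R]/(_%:R) natr_Zp pchar_Zp // subr0.
Qed.

Lemma centermK x : redm m (centerm x) = x.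
Proof. by apply/rowP => i; rewrite !mxE centerK. Qed.

Lemma center_min (u : int) : center u%:~R ^+ 2 <= u ^+ 2.
Proof.
have := center_bound u%:~R; set c := center _ => cb.
have /eqP : c%:~R = u%:~R :> 'Z_m by rewrite centerK.
rewrite intr_Zp_eq // => /dvdzP[q]; rewrite /m => cu.
rewrite -real_normK ?num_real // -[u ^+ 2]real_normK ?num_real // ler_sqr ?nnegrE //.
have [q0|[q1|q1]] : q = 0 \/ (1 <= q \/ q <= -1) by lia.
- by move: cu; rewrite q0; lia.
- have : k%:Z <= q * k%:Z by nia.
  lia.
- have : q * k%:Z <= - k%:Z by nia.
  lia.
Qed.

Lemma dvd_small (z : int) : (m %| z)%Z -> `|z| <= m%:Z -> z = 0 \/ `|z| = m%:Z.
Proof.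
rewrite dvdzE /=; case: (posnP `|z|%N) => [|z0 /(dvdn_leq z0)]; lia.
Qed.

Lemma center_eq (x : 'Z_m) (a : nat) : (a <= k)%N ->
  ((x == a%:R) || (x == - a%:R)) = (a == `|center x|%N).
Proof.
move=> ak; have xE := centerK x; have := center_bound x; set c := center x in xE *.
rewrite -xE -[a%:R]/(a%:Z%:~R) -mulrNz !intr_Zp_eq // => cb.
apply/idP/idP => [|/eqP ->].
  by move=> /orP[] /dvd_small; rewrite /m => H; apply/eqP; lia.
by case: (ger0P c) => c0; apply/orP; [left|right]; rewrite (_ : _ - _ = 0) //; lia.
Qed.

(** An entry is counted only for a = |center x_i|, and once even at a = k, where a and -a agree
    modulo 2k. A zero entry is never counted. *)
Lemma euclid_wtE (x : 'rV['Z_m]_n) : (euclid_wt x)%:Z = dot (centerm x) (centerm x).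
Proof.
rewrite /euclid_wt dotE.
have -> : (\sum_(1 <= a < m./2.+1) n_alpha a x * a ^ 2 =
           \sum_i `|center (x 0%R i)| ^ 2)%N.
  under eq_bigr => a _ do rewrite /n_alpha -sum1dep_card big_distrl.
  rewrite (exchange_big_dep predT) //=; apply: eq_bigr => i _.
  have mk : m./2 = k by rewrite /m mul2n doubleK.
  have := center_bound (x 0 i); move: (@center_eq (x 0 i)); set c := center _ => cE cb.
  rewrite big_mkcond big_nat mk.
  under eq_bigr => a /andP[_ ak] do rewrite cE // mul1n.
  rewrite -big_nat -big_mkcond /= big_nat1_eq ltnS; case: ifP => //; lia.
by rewrite (big_morph Posz PoszD (erefl 0%Z)); apply: eq_bigr => i _; rewrite !mxE; lia.
Qed.
End EuclideanWeight.

(** * Codes from frames of an even unimodular lattice *)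

Section FrameCode.
(** The lattice carries the scalar product [dot / d]: [LP] makes it unimodular, [L_even] even, and
    [FF] makes the rows of F orthogonal of norm 2k. *)
Variables (d k n : nat) (L : pred 'rV[int]_n) (F : 'M[int]_n).
Hypotheses (d_gt0 : (0 < d)%N) (k_gt0 : (0 < k)%N).
Let m := (2 * k)%N.
Hypothesis LP : forall h, L h <-> (forall g, L g -> (d %| dot h g)%Z).
Hypothesis L_even : forall h, L h -> ((2 * d)%N %| dot h h)%Z.
Hypothesis LF : forall i, L (row i F).
Hypothesis FF : F *m F^T = (d * m)%:Z%:M.
(** The bound is asked only of vectors that come from centered lifts. This admits frames whose own
    norm 2k is below 6, as for k = 1 and k = 2. In [L_six], the last condition makes the codeword
    nonzero. *)
Hypothesis L_min : forall h, L h -> h != 0 ->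
  (forall i, `|dot h (row i F)| <= (d * k)%:Z) -> (6 * d)%:Z <= dot h h.
Hypothesis L_six : exists2 h, L h & dot h h = (6 * d)%:Z /\
  exists i, ~~ ((d * m)%N %| dot h (row i F))%Z.

Let m_gt1 : (1 < m)%N. Proof. by rewrite /m; lia. Qed.
Let d_neq0 : d%:Z != 0. Proof. by lia. Qed.
Let m_neq0 : m%:Z != 0. Proof. by rewrite /m; lia. Qed.
Let dm : (d * m)%:Z = d%:Z * m%:Z. Proof. by lia. Qed.

Let L_int h g : L h -> L g -> (d %| dot h g)%Z.
Proof. by move=> /LP; apply. Qed.

Let LD h g : L h -> L g -> L (h + g).
Proof. by move=> Lh Lg; apply/LP => l Ll; rewrite dotDl rpredD // L_int. Qed.

Let L_sum (t : 'rV[int]_n) : L (t *m F).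
Proof.
apply/LP => g Lg; rewrite /dot -mulmxA mxE; apply: rpred_sum => j _.
apply: dvdz_mull; have := L_int (LF j) Lg.
by rewrite dot_rowl.
Qed.

Let L_Fdiv h : L h -> exists w : 'rV[int]_n, h *m F^T = d%:Z *: w.
Proof.
move=> Lh; exists (map_mx (divz^~ d) (h *m F^T)); apply: dvd_rowP => i.
by have := L_int Lh (LF i); rewrite dot_rowr.
Qed.

Let FtF : F^T *m F = (d * m)%:Z%:M.
Proof. by apply: mul_tr_scalarC FF; rewrite dm mulf_neq0. Qed.

Let FdivK (h w : 'rV[int]_n) : h *m F^T = d%:Z *: w -> w *m F = m%:Z *: h.
Proof.
move=> hw; apply: (scale_row_inj d_neq0).
by rewrite scalerA -dm scalemxAl -hw -mulmxA FtF mul_mx_scalar.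
Qed.

(** Parseval's identity: w / m are the coordinates of h in the frame. *)
Let dot_frame (h w : 'rV[int]_n) : h *m F^T = d%:Z *: w -> d%:Z * dot w w = m%:Z * dot h h.
Proof.
move=> hw; apply: (mulfI d_neq0).
have : dot (h *m F^T) (h *m F^T) = d%:Z * (m%:Z * dot h h).
  rewrite /dot trmx_mul trmxK -mulmxA [F^T *m _]mulmxA FtF mul_scalar_mx -scalemxAr mxE dm.
  by rewrite -mulrA.
by rewrite hw dotZl dotC dotZl.
Qed.

Definition frame_code : {set 'rV['Z_m]_n} := 
  [set x | [forall i, (m %| (liftm x *m F) 0%R i)%Z] && L (map_mx (divz^~ m) (liftm x *m F))].

(** Another lift changes u F by m times an element of L, so any lift may be tested. *)
Let codeP u : redm m u \in frame_code <-> exists2 h, L h & u *m F = m%:Z *: h.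
Proof.
have [t ut] : exists t, liftm (redm m u) = u + m%:Z *: t.
  by apply/(@redm_eqP m n m_gt1); rewrite liftmK.
rewrite inE; split=> [/andP[/forallP dv Lh]|[h Lh uF]].
  exists (map_mx (divz^~ m%:Z) (liftm (redm m u) *m F) + (- t) *m F); first exact: LD Lh (L_sum (- t)).
  by rewrite scalerDr -dvd_rowP // ut mulmxDl mulNmx -scalemxAl scalerN addrK.
have -> : liftm (redm m u) *m F = m%:Z *: (h + t *m F).
  by rewrite ut mulmxDl uF -scalemxAl scalerDr.
apply/andP; split; first by apply/forallP => i; rewrite mxE dvdz_mulr.
have -> : map_mx (divz^~ m) (m%:Z *: (h + t *m F)) = h + t *m F; last exact: LD Lh (L_sum t).
by apply/rowP => i; rewrite !mxE mulrC mulzK.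
Qed.

Let code_self_dual : self_dual frame_code.
Proof.
split.
  split.
  - have -> : 0 = redm m 0 :> 'rV_n by apply/rowP => i; rewrite !mxE.
    by apply/codeP; exists 0; rewrite ?mul0mx ?scaler0 // -(mul0mx _ F).
  - move=> x y; rewrite -(liftmK x) -(liftmK y) -redmD.
    move=> /codeP[h Lh hE] /codeP[g Lg gE]; apply/codeP.
    by exists (h + g); [exact: LD | rewrite mulmxDl hE gE scalerDr].
  - move=> a x; rewrite -(liftmK x) => /codeP[h Lh hE].
    have -> : a *: redm m (liftm x) = redm m ((nat_of_ord a)%:Z *: liftm x).
      by apply/rowP => i; rewrite !mxE rmorphM /= -[_%:~R in RHS]/(_%:R) natr_Zp.
    apply/codeP; exists ((nat_of_ord a)%:Z *: h); last by rewrite -scalemxAl hE !scalerA mulrC.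
    by apply/LP => g Lg; rewrite dotZl dvdz_mull // L_int.
apply/setP => x; rewrite -(liftmK x) [in RHS]inE; set u := liftm x.
apply/idP/idP => [/codeP[h Lh hE]|/forallP dual].
  apply/forallP => y; apply/implyP; rewrite -(liftmK y) => /codeP[g Lg gE].
  rewrite inner_redm //; set v := liftm y in gE *.
  have /dvdzP[q qE] := L_int Lh Lg; apply/dvdzP; exists q.
  apply: (mulfI (_ : (d * m)%:Z != 0)); first by rewrite dm mulf_neq0.
  have : dot (u *m F) (v *m F) = (d * m)%:Z * dot u v.
    by rewrite /dot trmx_mul -mulmxA [F *m _]mulmxA FF mul_scalar_mx -scalemxAr mxE.
  by rewrite hE gE dotZl dotC dotZl dotC qE dm => <-; ring.
(* The coordinates of g in the frame give a codeword, and orthogonality of u to it becomes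
   divisibility of the product of u F with g. *)
have dv g : L g -> ((d * m)%N %| dot (u *m F) g)%Z.
  move=> Lg; have [w wE] := L_Fdiv Lg.
  have /implyP := dual (redm m w); rewrite inner_redm // => dual_w.
  have /dual_w /dvdzP[q qE] : redm m w \in frame_code.
    by apply/codeP; exists g => //; exact: FdivK.
  apply/dvdzP; exists q; rewrite dotC /dot trmx_mul mulmxA wE -scalemxAl mxE.
  by rewrite -/(dot w u) dotC qE dm; ring.
(* Pairing u F with these vectors shows that m divides its entries; the quotient then lies in the
   dual of L, which is L. *)
have L_unit i : L (d%:Z *: delta_mx 0 i).
  by apply/LP => g _; rewrite dotZl dvdz_mulr.
have uE : u *m F = m%:Z *: map_mx (divz^~ m%:Z) (u *m F).
  apply: dvd_rowP => i; have := dv _ (L_unit i).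
  rewrite dotC dotZl dm dvdz_mul2l //.
  by rewrite /dot -rowE !mxE.
apply/codeP; exists (map_mx (divz^~ m%:Z) (u *m F)) => //.
by apply/LP => g /dv; rewrite {1}uE dotZl dm [d%:Z * _]mulrC dvdz_mul2l.
Qed.

Let code_wt c : c \in frame_code -> exists2 h, L h &
  [/\ redm m (centerm c) = c, centerm c *m F = m%:Z *: h & h *m F^T = d%:Z *: centerm c].
Proof.
rewrite -{1}(centermK k_gt0 c) => /codeP[h Lh hE]; exists h => //; split=> //.
  exact: centermK.
apply: (scale_row_inj m_neq0).
by rewrite scalemxAl -hE -mulmxA FF mul_mx_scalar scalerA mulrC dm.
Qed.

Lemma frame_code_typeII : typeII frame_code.
Proof.
split; first exact: code_self_dual.
move=> c /code_wt[h Lh [_ _ /dot_frame]]; rewrite -euclid_wtE //.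
have /dvdzP[q ->] := L_even Lh; rewrite /m => E.
suff : (euclid_wt c)%:Z = q * (4 * k)%:Z by move=> E'; rewrite -[X in is_true X]/((4 * k)%N %| (euclid_wt c)%:Z)%Z E' dvdz_mull.
by apply: (mulfI d_neq0); rewrite E; lia.
Qed.

Lemma frame_code_min : min_euclid_wt frame_code (12 * k).
Proof.
have wt_ge c : c \in frame_code -> c != 0 -> (12 * k <= euclid_wt c)%N.
  move=> /code_wt[h Lh [cE hE wE]] c0.
  have h0 : h != 0.
    apply: contraNneq c0 => h0; move: wE; rewrite h0 mul0mx => /esym/eqP.
    rewrite -(scaler0 _ d%:Z) (inj_eq (scale_row_inj d_neq0)) => /eqP cen0; rewrite -cE cen0.
    by rewrite redm_eq0 //; apply/forallP => i; rewrite mxE dvdz0.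
  have : (6 * d)%:Z <= dot h h.
    apply: L_min => // i; have -> : dot h (row i F) = d%:Z * centerm c 0 i.
      by rewrite dot_rowr wE mxE.
    by rewrite mxE normrM PoszM ler_wpM2l ?center_bound.
  have := dot_frame wE; rewrite -euclid_wtE // /m => E.
  by move=> hh; rewrite -lez_nat -(@ler_pM2l _ d%:Z); nia.
split=> //; have [h Lh [hh [i hi]]] := L_six.
have [w wE] := L_Fdiv Lh; exists (redm m w).
  by apply/codeP; exists h => //; exact: FdivK.
have w0 : redm m w != 0.
  rewrite redm_eq0 //; apply/forallPn; exists i; apply: contra hi.
  have -> : dot h (row i F) = d%:Z * w 0 i.
    by rewrite dot_rowr wE mxE.
  by move=> mw; rewrite dm dvdz_mul.
rewrite w0 eqn_leq wt_ge ?andbT //; last by apply/codeP; exists h => //; exact: FdivK.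
(* The centered lift is the shortest one, so this codeword weighs at most 12k. *)
have : (euclid_wt (redm m w))%:Z <= dot w w.
  rewrite euclid_wtE // !dotE; apply: ler_sum => j _.
  by rewrite !mxE -!expr2; exact: center_min.
have := dot_frame wE; rewrite hh /m => E le_w.
by rewrite -lez_nat; apply: le_trans le_w _; nia.
Qed.

End FrameCode.

(** * Exhaustive search for low-weight combinations of rows *)

Definition wt (R : nmodType) n (u : 'rV[R]_n) : nat := (\sum_i (u 0%R i != 0%R))%N.

Lemma wt_eq0 (R : nmodType) n (u : 'rV[R]_n) : (wt u == 0%N) = (u == 0).
Proof.
rewrite /wt sum_nat_eq0; apply/forallP/eqP => [u0|-> i]; last by rewrite mxE eqxx.
by apply/rowP => i; rewrite mxE; apply/eqP; have := u0 i; rewrite eqb0 negbK.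
Qed.

Lemma wt_count (R : nmodType) n (y : 'rV[R]_n.+1) s : perm_eq s (iota 0 n.+1) ->
  wt y = count (fun i => y 0 (inord i) != 0) s.
Proof.
move=> /seq.permP ->; rewrite -sum1_count big_mkcond -[iota _ _]/(index_iota 0 n.+1).
by rewrite big_mkord; apply: eq_bigr => i _; rewrite inord_val; case: (_ != _).
Qed.

Lemma wt_le (R : nmodType) n (u : 'rV[R]_n) : (wt u <= n)%N.
Proof. by rewrite -[X in (_ <= X)%N]card_ord -sum1_card leq_sum // => i _; case: (_ != _). Qed.

Lemma wt_row_mx (R : nmodType) m n (u : 'rV[R]_m) (v : 'rV[R]_n) : wt (row_mx u v) = (wt u + wt v)%N.
Proof.
rewrite /wt big_split_ord; congr (_ + _)%N; apply: eq_bigr => i _; by rewrite ?row_mxEl ?row_mxEr.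
Qed.

Section Search.
Variables (A : eqType) (add : A -> A -> A) (nz : A -> bool).

Fixpoint addv (v w : seq A) : seq A :=
  match v, w with x :: v', y :: w' => add x y :: addv v' w' | _, _ => [::] end.

(* [far v w t] decides whether [addv v w] has more than [t] nonzero entries, stopping at the [t+1]st. *)
Fixpoint far (v w : seq A) (t : nat) : bool :=
  match v, w with
  | x :: v', y :: w' =>
    if nz (add x y) then (if t is t'.+1 then far v' w' t' else true) else far v' w' t
  | _, _ => false
  end.

Fixpoint far_all (rows : seq (seq (seq A))) (v : seq A) (t : nat) : bool :=
  if rows is r :: rows' then all (fun x => far v x t) r && far_all rows' v t else true.

(* An entry of [rows] lists the nonzero multiples of one generator.  The search adds to [v] multiples
   of at most [k] generators and requires more than [t - (s - 1)] nonzero entries after [s] additions. *)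
Fixpoint search (k : nat) : seq (seq (seq A)) -> seq A -> nat -> bool :=
  match k with
  | 0 => fun _ _ _ => true
  | 1 => far_all
  | k'.+1 => fix go rows v t :=
    if rows is r :: rows' then
      all (fun x => far v x t && search k' rows' (addv v x) t.-1) r && go rows' v t
    else true
  end.

Variables (R : nmodType) (f : A -> R) (a0 : A) (n : nat).
Hypothesis fD : {morph f : x y / add x y >-> x + y}.
Hypothesis f_nz : forall x, nz x = (f x != 0).

Definition den (v : seq A) : 'rV[R]_n := \row_i f (nth a0 v i).

Lemma farE v w t : far v w t = (t < count nz (addv v w))%N.
Proof.
elim: v w t => [|x v IH] [|y w] t //=.
by case: (nz _) => //=; case: t => [|t] //=; rewrite IH.
Qed.

Lemma size_addv v w : size v = n -> size w = n -> size (addv v w) = n.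
Proof. by elim: v w n => [|x v IH] [|y w] [|m] //= [sv] [sw]; rewrite (IH w m). Qed.

Lemma nth_addv v w i : size v = n -> size w = n -> (i < n)%N ->
  nth a0 (addv v w) i = add (nth a0 v i) (nth a0 w i).
Proof.
by elim: v w n i => [|x v IH] [|y w] [|m] [|i] //= [sv] [sw] im; rewrite (IH w m).
Qed.

Lemma den_addv v w : size v = n -> size w = n -> den (addv v w) = den v + den w.
Proof. by move=> sv sw; apply/rowP => i; rewrite !mxE nth_addv. Qed.

Lemma wt_den v : size v = n -> wt (den v) = count nz v.
Proof.
move=> sv; rewrite -sum1_count big_mkcond (big_nth a0) sv big_mkord.
by apply: eq_bigr => i _; rewrite mxE f_nz; case: eqP.
Qed.

Lemma searchS k r rows v t : search k.+1 (r :: rows) v t =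
  all (fun x => far v x t && search k rows (addv v x) t.-1) r && search k.+1 rows v t.
Proof. by case: k => //=; under [in RHS]eq_all => x do rewrite andbT. Qed.

(** Lowering the threshold with each generator bounds the weight of the sum plus the number of
    terms, which for a word (y, yP) is the total weight. *)
Lemma search_sound k rows v t (us : seq 'rV[R]_n) :
    search k rows v t -> size v = n -> all (all (fun x => size x == n)) rows ->
    all2 (fun r u => (u == 0) || (u \in map den r)) rows us ->
    (0 < count (predC1 0%R) us <= k)%N ->
  (t < wt (den v + \sum_(u <- us) u)%R + (count (predC1 0%R) us).-1)%N.
Proof.
have count0 (us0 : seq 'rV[R]_n) : count (predC1 0) us0 = 0%N -> \sum_(u <- us0) u = 0.
  by elim: us0 => [|u us0 IH]; rewrite ?big_nil // big_cons /=; case: eqP => //= -> /IH ->; rewrite addr0.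
elim: k rows v t us => [|k IHk]; first by move=> rows v t us; case: (count _ _).
elim=> [|r rows IHr] v t [|u us] //.
rewrite searchS => /andP[/allP hr hrows] sv /= /andP[sr srows] /andP[ur usr].
case: (eqVneq u 0) ur => [-> _|u0 /= /mapP[x xr ux]]; first by rewrite big_cons add0r; exact: IHr.
have /andP[far_x search_x] := hr x xr; have sx := eqP (allP sr x xr).
rewrite big_cons addrA ux -den_addv //= add1n /= ltnS => us_k.
case: (posnP (count (predC1 0) us)) => [us0|us_gt0].
  by rewrite count0 // us0 addr0 !addn0 wt_den ?size_addv //; move: far_x; rewrite farE.
(* At t = 0 the predecessor truncates, which is harmless because another nonzero term remains. *)
have predn_lt a b c : (0 < c -> a.-1 < b + c.-1 -> a < b + c)%N by lia.
apply: (predn_lt _ _ _ us_gt0); apply: (IHk _ _ _ _ search_x (size_addv sv sx) srows usr).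
by rewrite us_gt0.
Qed.
End Search.

(* The generators indexed by [s] are those still available, and [v] is the contribution of the others. *)
Lemma search_mulmx (A : eqType) (add : A -> A -> A) (nz : A -> bool) (F : fieldType) (f : A -> F) (a0 : A) n m
    (fD : {morph f : x y / add x y >-> x + y}) (f_nz : forall x, nz x = (f x != 0))
    (P : 'M[F]_(n.+1, m)) (gens : nat -> seq (seq A)) k t v (s : seq nat) (y : 'rV[F]_n.+1) :
    (forall i : 'I_n.+1, row i P != 0) ->
    (forall i : 'I_n.+1, all (fun x => size x == m) (gens i)) ->
    (forall (i : 'I_n.+1) c, c != 0 -> c *: row i P \in map (den f a0 m) (gens i)) ->
    search add nz k (map gens s) v t ->
    all (gtn n.+1) s && uniq s -> size v = m ->
    den f a0 m v = \sum_(i < n.+1 | (i : nat) \notin s) y 0 i *: row i P ->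
    (0 < count (fun i => y 0%R (inord i) != 0%R) s <= k)%N ->
  (t < wt (y *m P)%R + (count (fun i => y 0%R (inord i) != 0%R) s).-1)%N.
Proof.
move=> P0 size_gens gensP srch /andP[/allP s_lt s_uniq] sv dv cnt.
pose us := [seq y 0 (inord i) *: row (inord i) P | i <- s].
have row0 i c : (c *: row i P == 0) = (c == 0) by rewrite scaler_eq0 (negPf (P0 i)) orbF.
have cntE : count (predC1 0) us = count (fun i => y 0 (inord i) != 0) s.
  by rewrite count_map; apply: eq_count => i /=; rewrite row0.
have usE : y *m P = den f a0 m v + \sum_(u <- us) u.
  rewrite mulmx_sum_row (bigID (fun i : 'I_n.+1 => (i : nat) \in s)) /= addrC dv; congr (_ + _).
  rewrite big_map -(big_map inord xpredT (fun i => y 0 i *: row i P)) -big_filter.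
  apply/perm_big/uniq_perm.
  - by rewrite filter_uniq // index_enum_uniq.
  - rewrite map_inj_in_uniq // => i j /s_lt /= i_lt /s_lt /= j_lt /(congr1 val).
    by rewrite /= !inordK.
  - move=> i; rewrite mem_filter mem_index_enum andbT; apply/idP/mapP => [si|[j js ->]].
      by exists (i : nat) => //; rewrite inord_val.
    by rewrite inordK //; exact: s_lt.
rewrite usE -cntE; apply: (@search_sound _ _ _ _ _ a0 m fD f_nz _ _ _ _ _ srch) => //.
- by apply/allP => r /mapP[i /s_lt /= i_lt ->]; rewrite -[i](inordK i_lt) size_gens.
- rewrite /us; elim: (s) s_lt => [|i s' IH] //= s_lt; rewrite IH ?andbT => [|j js]; last first.
    by apply: s_lt; rewrite inE js orbT.
  have i_lt : (i < n.+1)%N by apply: s_lt; rewrite inE eqxx.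
  rewrite row0; case: eqVneq => //= yi0.
  by have := gensP (inord i) _ yi0; rewrite inordK.
- by rewrite cntE.
Qed.

(** * Integer matrices given by tables *)

Definition mxtab (t : seq (seq int)) : 'M[int]_24 := \matrix_(i, j) nth 0 (nth [::] t i) j.
Definition tab24 (f : nat -> nat -> int) := mkseq (fun i => mkseq (f i) 24) 24.

Fixpoint seqdot (u v : seq int) : int :=
  match u, v with x :: u', y :: v' => x * y + seqdot u' v' | _, _ => 0 end.
(** Rows are paired with rows, so this is [s] times the transpose of [t]. *)
Definition mulT (s t : seq (seq int)) := [seq [seq seqdot r c | c <- t] | r <- s].
Definition is_tab24 (t : seq (seq int)) := (size t == 24) && all (fun r => size r == 24) t.

Definition tab_all2 (r : nat -> nat -> int -> int -> bool) (s t : seq (seq int)) :=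
  all (fun i => all (fun j => r i j (nth 0 (nth [::] s i) j) (nth 0 (nth [::] t i) j)) (iota 0 24)) (iota 0 24).

Lemma tab_all2P r s t (i j : 'I_24) : tab_all2 r s t -> r i j (mxtab s i j) (mxtab t i j).
Proof.
move=> /allP/(_ (i : nat)); rewrite mem_iota ltn_ord => /(_ isT) /allP/(_ (j : nat)).
by rewrite mem_iota ltn_ord !mxE; apply.
Qed.

Lemma seqdotE n (u v : seq int) : size u = n -> size v = n ->
  seqdot u v = \sum_(i < n) nth 0 u i * nth 0 v i.
Proof.
elim: n u v => [|n IH] u v; first by move=> /size0nil ->; rewrite big_ord0.
case: u v => [|x u] [|y v] //= [su] [sv].
by rewrite big_ord_recl /= (IH u v).
Qed.

Lemma mxtab_mulT s t : is_tab24 s -> is_tab24 t -> mxtab s *m (mxtab t)^T = mxtab (mulT s t).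
Proof.
move=> /andP[/eqP ss /allP rs] /andP[/eqP st /allP rt]; apply/matrixP => i j.
rewrite !mxE (nth_map [::]) ?ss // (nth_map [::]) ?st // (@seqdotE 24).
- by apply: eq_bigr => k _; rewrite !mxE.
- by apply/eqP/rs/mem_nth; rewrite ss.
- by apply/eqP/rt/mem_nth; rewrite st.
Qed.

(* The points of the projective line over F_23: [0] is the point at infinity and [j.+1] is [j]. *)
Definition pt (i : nat) : nat * nat := if i is j.+1 then (j, 1%N) else (1%N, 0%N).

Definition legendre23 (a : nat) : int :=
  if (23 %| a)%N then 0 else
  if (a %% 23)%N \in [:: 1; 2; 3; 4; 6; 8; 9; 12; 13; 16; 18]%N then 1 else -1.

(* The Legendre symbol of [det (pt i, pt j)]; as -1 is not a square mod 23, this is skew. *)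
Definition paley_fun (i j : nat) : int :=
  legendre23 ((pt i).1 * (pt j).2 + 22 * ((pt i).2 * (pt j).1))%N.
Definition paley_tab := Eval vm_compute in tab24 paley_fun.
Definition paley := mxtab paley_tab.

Definition inv23 (a : nat) : nat := find (fun b => (a * b) %% 23 == 1)%N (iota 0 23).

(* The matrix [(a, b; c, d)] of SL_2(23) acts by signed permutations: index and sign of the image of [i]. *)
Definition mono (g : nat * nat * nat * nat) (i : nat) : nat * int :=
  let: (a, b, c, d) := g in
  let x := (a * (pt i).1 + b * (pt i).2)%N in
  let y := (c * (pt i).1 + d * (pt i).2)%N in
  if (23 %| y)%N then (0%N, legendre23 x) else (((x * inv23 y) %% 23).+1, legendre23 y).

Definition mono_fun g i j : int := let: (p, s) := mono g i in if j == p then s else 0.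

(** Three matrices of trace 0 in SL_2(23), the third being the product of the first two: they
    generate a quaternion group of order 8. *)
Definition quat1_tab := Eval vm_compute in tab24 (mono_fun (0, 22, 1, 0)%N).
Definition quat2_tab := Eval vm_compute in tab24 (mono_fun (2, 8, 8, 21)%N).
Definition quat3_tab := Eval vm_compute in tab24 (mono_fun (15, 2, 2, 8)%N).
Definition quat1 := mxtab quat1_tab.
Definition quat2 := mxtab quat2_tab.
Definition quat3 := mxtab quat3_tab.

Ltac tab_check := by vm_cast_no_check (erefl true).

Lemma mxtab_mul_trP r s s' t t' (i j : 'I_24) :
    all is_tab24 [:: s; s'; t; t'] && tab_all2 r (mulT s s') (mulT t t') ->
  r i j ((mxtab s *m (mxtab s')^T) i j) ((mxtab t *m (mxtab t')^T) i j).
Proof.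
move=> /andP[/and5P[s24 s'24 t24 t'24 _]] /(tab_all2P i j).
by rewrite !mxtab_mulT.
Qed.

Lemma mxtab_trN t : tab_all2 (fun i j a _ => nth 0 (nth [::] t j) i == - a) t t -> (mxtab t)^T = - mxtab t.
Proof. by move=> tN; apply/matrixP => i j; have /eqP := tab_all2P i j tN; rewrite !mxE. Qed.

Lemma paley_tr : paley^T = - paley.
Proof. by apply: mxtab_trN; tab_check. Qed.

Lemma quat_tr : [/\ quat1^T = - quat1, quat2^T = - quat2 & quat3^T = - quat3].
Proof. by split; apply: mxtab_trN; tab_check. Qed.

Lemma mxtab_mul_tr_scalar c t :
    all is_tab24 [:: t; t; t; t] &&
    tab_all2 (fun i j a _ => a == if i == j then c else 0) (mulT t t) (mulT t t) ->
  mxtab t *m (mxtab t)^T = c%:M.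
Proof.
move=> tc; apply/matrixP => i j; have /eqP -> := mxtab_mul_trP i j tc.
by rewrite mxE val_eqE; case: eqP.
Qed.

Lemma paley_mul_tr : paley *m paley^T = 23%:M.
Proof. by apply: mxtab_mul_tr_scalar; tab_check. Qed.

Lemma quat_norm : [/\ quat1 *m quat1^T = 1%:M, quat2 *m quat2^T = 1%:M & quat3 *m quat3^T = 1%:M].
Proof. by split; apply: mxtab_mul_tr_scalar; tab_check. Qed.

Lemma quat_anti : [/\ quat1 *m quat2^T = - (quat2 *m quat1^T),
  quat1 *m quat3^T = - (quat3 *m quat1^T) & quat2 *m quat3^T = - (quat3 *m quat2^T)].
Proof.
have anti s t : all is_tab24 [:: s; t; t; s] &&
    tab_all2 (fun _ _ a b => a == - b) (mulT s t) (mulT t s) ->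
    mxtab s *m (mxtab t)^T = - (mxtab t *m (mxtab s)^T).
  by move=> st; apply/matrixP => i j; have /eqP -> := mxtab_mul_trP i j st; rewrite [RHS]mxE.
by split; apply: anti; tab_check.
Qed.

(** SL_2(23) preserves the determinants whose Legendre symbols are the entries of [paley]; here this
    is checked on the tables. *)
Lemma quat_paley : [/\ quat1 *m paley = paley *m quat1, quat2 *m paley = paley *m quat2
  & quat3 *m paley = paley *m quat3].
Proof.
have comm t : (mxtab t)^T = - mxtab t ->
    all is_tab24 [:: t; paley_tab; paley_tab; t] &&
    tab_all2 (fun _ _ a b => a == b) (mulT t paley_tab) (mulT paley_tab t) ->
    mxtab t *m paley = paley *m mxtab t.
  (* By skewness both sides are, up to sign, products with a transpose, the form that [mulT]
     computes. *)
  move=> trt tP; apply: oppr_inj; rewrite -!mulmxN -paley_tr -trt; apply/matrixP => i j.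
  by have /eqP := mxtab_mul_trP i j tP.
by have [t1 t2 t3] := quat_tr; split; apply: comm => //; tab_check.
Qed.

Definition sl2_mul (g h : nat * nat * nat * nat) : nat * nat * nat * nat :=
  let: (a, b, c, d) := g in let: (a', b', c', d') := h in
  ((a * a' + b * c') %% 23, (a * b' + b * d') %% 23, (c * a' + d * c') %% 23, (c * b' + d * d') %% 23)%N.

(* Two elements of SL_2(23), of orders 24 and 4, generating a dicyclic group of order 48 whose quotient
   by -1 is regular on the points. *)
Definition dicyclic : seq (nat * nat * nat * nat) :=
  let pows := traject (fun h => sl2_mul h (0, 1, 22, 3)%N) (1, 0, 0, 1)%N 12 in
  pows ++ map (sl2_mul (1, 21, 1, 22)%N) pows.

Definition orbit_tab (v : seq int) : seq (seq int) :=
  [seq foldr (fun i r => let: (p, s) := mono g i in set_nth 0 r p (s * nth 0 v i)) (nseq 24 0) (iota 0 24)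
  | g <- dicyclic].

(* The halves of a vector of norm 10, found by a random search, whose images under the dicyclic group and
   the exchange of the halves are pairwise orthogonal up to sign. *)
Definition ten1_tab := Eval vm_compute in orbit_tab
  [:: 0; -1; -1; 1; 1; 0; 1; 0; 1; -1; 0; -1; -1; 0; 0; 1; 0; -1; 1; -1; -1; 1; 1; 1].
Definition ten2_tab := Eval vm_compute in orbit_tab
  [:: -1; 0; 0; 0; 0; 0; 0; 1; 1; 0; 1; -1; 1; -1; -1; 1; 0; 0; -1; 0; 0; -1; 1; -1].
Definition ten1 := mxtab ten1_tab.
Definition ten2 := mxtab ten2_tab.

(** The scalar 30 is [6 * k] for k = 5, that is, norm 10 after division by 3. *)
Lemma ten_norm : ten1 *m ten1^T + ten2 *m ten2^T = 30%:M.
Proof.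
have e : all is_tab24 [:: ten1_tab; ten1_tab; ten2_tab; ten2_tab] &&
    tab_all2 (fun i j a b => a + b == if i == j then 30 else 0) (mulT ten1_tab ten1_tab) (mulT ten2_tab ten2_tab).
  by tab_check.
apply/matrixP => i j; rewrite [LHS]mxE (eqP (mxtab_mul_trP i j e)).
by rewrite mxE val_eqE; case: eqP.
Qed.

Lemma ten_orth : ten1 *m ten2^T + ten2 *m ten1^T = 0.
Proof.
have e : all is_tab24 [:: ten1_tab; ten2_tab; ten2_tab; ten1_tab] &&
    tab_all2 (fun _ _ a b => a + b == 0) (mulT ten1_tab ten2_tab) (mulT ten2_tab ten1_tab) by tab_check.
by apply/matrixP => i j; rewrite [LHS]mxE (eqP (mxtab_mul_trP i j e)) mxE.
Qed.

Lemma ten_code i j : (3 %| (ten2 - ten1 *m paley)%R i j)%Z.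
Proof.
have e : tab_all2 (fun _ _ a b => 3 %| a + b)%Z ten2_tab (mulT ten1_tab paley_tab) by tab_check.
have -> : ten1 *m paley = - mxtab (mulT ten1_tab paley_tab).
  by rewrite -mxtab_mulT ?[(mxtab _)^T]paley_tr ?mulmxN ?opprK.
by rewrite opprK [X in (_ %| X)%Z]mxE (tab_all2P i j e).
Qed.

(** * Minimum weight of the Pless symmetry code *)

(** A copy of F_3 by bare constructors, on which the exhaustive search computes quickly. *)
Inductive trit := T0 | T1 | T2.
Definition trit_eqb (x y : trit) := match x, y with T0, T0 | T1, T1 | T2, T2 => true | _, _ => false end.
Lemma trit_eqP : Equality.axiom trit_eqb. Proof. by case; case; constructor. Qed.
HB.instance Definition _ := hasDecEq.Build trit trit_eqP.

Definition trit_add (x y : trit) : trit :=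
  match x, y with
  | T0, _ => y | _, T0 => x | T1, T1 => T2 | T2, T2 => T1 | _, _ => T0
  end.
Definition trit_opp (x : trit) : trit := match x with T0 => T0 | T1 => T2 | T2 => T1 end.
Definition trit_nz (x : trit) : bool := if x is T0 then false else true.
Definition trit_val (x : trit) : 'F_3 := match x with T0 => 0 | T1 => 1 | T2 => -1 end.
Definition trit_of (x : int) : trit := if x == 1 then T1 else if x == -1 then T2 else T0.

Lemma trit_valD : {morph trit_val : x y / trit_add x y >-> x + y}.
Proof. by case; case; apply/eqP. Qed.

Lemma trit_valN x : trit_val (trit_opp x) = - trit_val x.
Proof. by case: x; apply/eqP. Qed.

Lemma trit_nzE x : trit_nz x = (trit_val x != 0).
Proof. by case: x. Qed.

Lemma F3P (x : 'F_3) : [\/ x = 0, x = 1 | x = -1].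
Proof. by case: x => [[|[|[|]]]] // i; [constructor 1 | constructor 2 | constructor 3]; apply/eqP. Qed.

Definition paley3 : 'M['F_3]_24 := map_mx intr paley.

Lemma paley3_tr : paley3^T = - paley3.
Proof. by rewrite /paley3 map_trmx paley_tr map_mxN. Qed.

Lemma paley3_sqr : paley3 *m paley3 = 1%:M.
Proof.
apply: (can_inj (@opprK _)); rewrite -mulmxN -paley3_tr /paley3 map_trmx -map_mxM paley_mul_tr.
by rewrite map_scalar_mx -[- 1%:M]scaleN1r scale_scalar_mx mulr1; congr (_%:M); apply/eqP.
Qed.

Lemma paley3_mul_tr : paley3 *m paley3^T = - 1%:M.
Proof. by rewrite paley3_tr mulmxN paley3_sqr. Qed.

Definition paley_trit (i : nat) : seq trit := map trit_of (nth [::] paley_tab i).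
Definition paley_pm (i : nat) : seq (seq trit) := [:: paley_trit i; map trit_opp (paley_trit i)].
Definition den3 : seq trit -> 'rV['F_3]_24 := den trit_val T0 24.

Lemma size_paley_row (i : 'I_24) : size (nth [::] paley_tab i) = 24.
Proof.
have : all (fun i => size (nth [::] paley_tab i) == 24) (iota 0 24) by tab_check.
by move/allP => /(_ (i : nat)); rewrite mem_iota ltn_ord => /(_ isT)/eqP.
Qed.

Lemma den_paley_trit (i : 'I_24) : den3 (paley_trit i) = row i paley3.
Proof.
have entries : tab_all2 (fun _ _ a _ => a \in [:: 0; 1; -1]) paley_tab paley_tab by tab_check.
apply/rowP => j; have := tab_all2P i j entries.
by rewrite !mxE (nth_map 0) ?size_paley_row // !inE => /or3P[] /eqP ->; apply/eqP.
Qed.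

Lemma den_paley_inord i : (i < 24)%N -> den3 (paley_trit i) = row (inord i) paley3.
Proof. by move=> i24; rewrite -den_paley_trit inordK. Qed.

Lemma den_trit_opp (v : seq trit) : den3 (map trit_opp v) = - den3 v.
Proof.
apply/rowP => j; rewrite !mxE -trit_valN; congr trit_val.
case: (ltnP j (size v)) => jv; first by rewrite (nth_map T0).
by rewrite !nth_default ?size_map.
Qed.

Lemma search_paley k t v (s : seq nat) (y : 'rV['F_3]_24) :
    search trit_add trit_nz k (map paley_pm s) v t ->
    all (gtn 24) s && uniq s -> size v = 24 ->
    den3 v = \sum_(i < 24 | (i : nat) \notin s) y 0 i *: row i paley3 ->
    (0 < count (fun i => y 0%R (inord i) != 0%R) s <= k)%N ->
  (t < wt (y *m paley3)%R + (count (fun i => y 0%R (inord i) != 0%R) s).-1)%N.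
Proof.
apply: (search_mulmx trit_valD trit_nzE) => [i|i|i c c0].
- apply: contraTneq isT => /(congr1 (fun u => u *m paley3)).
  by rewrite mul0mx -row_mul paley3_sqr => /rowP/(_ i); rewrite !mxE eqxx.
- by rewrite /= !size_map size_paley_row.
rewrite !inE -/den3 den_trit_opp den_paley_trit.
by case: (F3P c) c0 => ->; rewrite ?eqxx // ?scale1r ?scaleN1r eqxx ?orbT.
Qed.

(** A putative counterexample to minimum weight above 12, with a left half of weight at most 6. *)
Definition low_wt (y : 'rV['F_3]_24) := (y != 0) && (wt y <= 6)%N && (wt y + wt (y *m paley3)%R <= 12)%N.

(** The search over one or two rows has threshold 11, which bounds the total weight minus 1. *)
Lemma low_wt3 y : low_wt y -> (2 < wt y)%N.
Proof.
move=> /andP[/andP[y0 _] tot]; rewrite ltnNge; apply/negP => y2.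
have := @search_paley 2 11 (nseq 24 T0) (iota 0 24) y.
rewrite -(wt_count _ (perm_refl _)).
have -> : search trit_add trit_nz 2 (map paley_pm (iota 0 24)) (nseq 24 T0) 11 by tab_check.
move=> /(_ isT isT erefl); rewrite big1 => [/(_ _)|i]; last by rewrite mem_iota ltn_ord.
have -> : den3 (nseq 24 T0) = 0 by apply/rowP => j; rewrite !mxE nth_nseq if_same; apply/eqP.
have y_gt0 : (0 < wt y)%N by rewrite lt0n wt_eq0.
by move=> /(_ erefl); rewrite y_gt0 => /(_ y2); lia.
Qed.

Definition paley_rest := 0%N :: iota 3 21.

(** Rows 1 and 2 are already added. With s further rows wt y = s + 2, and 9 < wt (yM) + s - 1 makes
    the total exceed 12. *)
Lemma search_rest1 : search trit_add trit_nz 4 (map paley_pm paley_rest)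
  (addv trit_add (paley_trit 1) (paley_trit 2)) 9.
Proof. tab_check. Qed.

Lemma search_rest2 : search trit_add trit_nz 4 (map paley_pm paley_rest)
  (addv trit_add (paley_trit 1) (map trit_opp (paley_trit 2))) 9.
Proof. tab_check. Qed.

Lemma low_wt12 y : low_wt y -> y 0 (inord 1) != 0 -> y 0 (inord 2) != 0 -> False.
Proof.
pose rest := paley_rest.
(* Replacing y by -y keeps all weights, which leaves two cases for the second coefficient. *)
wlog y1 : y / y 0 (inord 1) = 1.
  move=> wl low; case: (F3P (y 0 (inord 1))) => y1; first by rewrite y1 eqxx.
    exact: wl low.
  have wtN m (u : 'rV['F_3]_m) : wt (- u) = wt u.
    by apply: eq_bigr => i _; rewrite mxE oppr_eq0.
  have Ny i : (- y) 0 i = - y 0 i by rewrite mxE.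
  move=> y1n y2n; apply: (wl (- y)); rewrite ?Ny ?oppr_eq0.
  - by rewrite y1 opprK.
  - by rewrite /low_wt mulNmx !wtN oppr_eq0.
  - exact: y1n.
  - exact: y2n.
move=> low _ y2; have y_gt2 := low_wt3 low; move/andP: low => [/andP[y0 y6] tot].
have wtE : wt y = (count (fun i => y 0%R (inord i) != 0%R) rest).+2.
  rewrite (@wt_count _ 23 y (1 :: 2 :: rest)%N) //.
  by rewrite /= y1 y2 oner_eq0.
have sz1 : size (paley_trit 1) = 24 by [].
have sz2 : size (paley_trit 2) = 24 by [].
have sz2' : size (map trit_opp (paley_trit 2)) = 24 by [].
have dv w : size w = 24 -> den3 w = y 0 (inord 2) *: row (inord 2) paley3 ->
    den3 (addv trit_add (paley_trit 1) w) =
    \sum_(i < 24 | (i : nat) \notin rest) y 0 i *: row i paley3.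
  move=> sw dw; rewrite /den3 den_addv //; last exact: trit_valD.
  rewrite -/den3 dw (eq_bigl (mem [:: inord 1; inord 2])) => [|i].
    rewrite -big_uniq /=; last by rewrite inE -val_eqE /= !inordK.
    by rewrite !big_cons big_nil addr0 y1 scale1r den_paley_inord.
  rewrite /rest /paley_rest inE mem_iota negb_or !inE -!val_eqE /= !inordK //.
  by have := ltn_ord i; lia.
have fin w : den3 w = y 0 (inord 2) *: row (inord 2) paley3 -> size w = 24 ->
    ~~ search trit_add trit_nz 4 (map paley_pm rest) (addv trit_add (paley_trit 1) w) 9.
  move=> dw sw; apply/negP => srch.
  have := search_paley srch isT (size_addv _ sz1 sw) (dv w sw dw).
  by clear srch; rewrite -/rest; lia.
case: (F3P (y 0 (inord 2))) => y2E; first by rewrite y2E eqxx in y2.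
  have d2 : den3 (paley_trit 2) = y 0 (inord 2) *: row (inord 2) paley3.
    by rewrite y2E scale1r den_paley_inord.
  exact: (negP (fin _ d2 sz2) search_rest1).
have d2 : den3 (map trit_opp (paley_trit 2)) = y 0 (inord 2) *: row (inord 2) paley3.
  by rewrite y2E scaleN1r den_trit_opp den_paley_inord.
exact: (negP (fin _ d2 sz2') search_rest2).
Qed.

(* The affine maps [x -> x + 1] and [x -> 2 x] of F_23, fixing infinity, preserve the Paley matrix since 2 is a square. *)
Definition shift_fun (i : nat) : nat := if i is j.+1 then ((j + 1) %% 23).+1 else 0%N.
Definition dbl_fun (i : nat) : nat := if i is j.+1 then ((2 * j) %% 23).+1 else 0%N.

Definition nat_perm_ok (f : nat -> nat) :=
  [&& all (fun i => f i < 24)%N (iota 0 24), uniq (map f (iota 0 24)) &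
      all (fun i => all (fun j => nth 0 (nth [::] paley_tab (f i)) (f j) ==
                                  nth 0 (nth [::] paley_tab i) j) (iota 0 24)) (iota 0 24)].

Definition paley_aut (s : 'S_24) := forall i j, paley (s i) (s j) = paley i j.

Lemma nat_permP f : nat_perm_ok f -> exists2 s : 'S_24, paley_aut s & forall i, s i = f i :> nat.
Proof.
move=> /and3P[/allP f24 f_uniq /allP f_aut].
have f_lt (i : 'I_24) : (f i < 24)%N by apply: f24; rewrite mem_iota ltn_ord.
pose g (i : 'I_24) : 'I_24 := Ordinal (f_lt i).
have g_inj : injective g.
  move=> i j /(congr1 val) /= fij; apply: val_inj => /=.
  have n24 (l : 'I_24) : (l < size (iota 0 24))%N by rewrite size_iota.
  have := nth_uniq 0%N; move=> /(_ (map f (iota 0 24)) i j).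
  rewrite size_map !n24 => /(_ isT isT f_uniq).
  by rewrite !(nth_map 0%N) ?n24 // !nth_iota // !add0n fij eqxx => /esym/eqP.
exists (perm g_inj) => [i j|i]; last by rewrite permE.
rewrite !permE !mxE /=; have := f_aut (i : nat); rewrite mem_iota ltn_ord => /(_ isT)/allP/(_ (j : nat)).
by rewrite mem_iota ltn_ord => /(_ isT)/eqP.
Qed.

Lemma paley_autM s t : paley_aut s -> paley_aut t -> paley_aut (s * t).
Proof. by move=> sa ta i j; rewrite !permM ta sa. Qed.

Lemma paley_autX s k : paley_aut s -> paley_aut (s ^+ k).
Proof.
by move=> sa; elim: k => [|k IH] i j; rewrite ?expg0 ?perm1 // expgS (paley_autM sa IH).
Qed.

(** The maps x -> ax + b with a a nonzero square form a group of order 253. As -1 is not a square,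
    it is regular on the 253 unordered pairs of finite points. *)
Lemma paley_aut_pair (i j : 'I_24) : i != 0 -> j != 0 -> i != j ->
  exists2 s, paley_aut s & (s (inord 1) = i /\ s (inord 2) = j) \/ (s (inord 1) = j /\ s (inord 2) = i).
Proof.
have [sh sh_aut shE] : exists2 s : 'S_24, paley_aut s & forall i, s i = shift_fun i :> nat.
  by apply: nat_permP; tab_check.
have [db db_aut dbE] : exists2 s : 'S_24, paley_aut s & forall i, s i = dbl_fun i :> nat.
  by apply: nat_permP; tab_check.
pose w b a l := iter a shift_fun (iter b dbl_fun l).
have wE b a (l : 'I_24) : (db ^+ b * sh ^+ a)%g l = w b a l :> nat.
  rewrite permM !permX /w; elim: a => [|a IH] /=; last by rewrite shE IH.
  by elim: b => [|b IH] //=; rewrite dbE IH.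
(* Index 1 is the point 0, fixed by doubling and sent to i by i - 1 shifts; 2 has order 11 modulo
   23. *)
have : all (fun i => all (fun j => (i == j) || has (fun b =>
    ((w b i.-1 1 == i) && (w b i.-1 2 == j)) || ((w b j.-1 1 == j) && (w b j.-1 2 == i)))%N (iota 0 11))
  (iota 1 23)) (iota 1 23) by tab_check.
have rng (l : 'I_24) : l != 0 -> (l : nat) \in iota 1 23.
  by rewrite mem_iota lt0n ltn_ord andbT -val_eqE.
move=> /allP/(_ (i : nat)) + i0 j0 ij => /(_ (rng i i0)) /allP /(_ (j : nat) (rng j j0)).
rewrite val_eqE (negPf ij) orFb.
move/hasP => [b _ /orP[] /andP[/eqP w1 /eqP w2]].
  exists (db ^+ b * sh ^+ i.-1)%g; first by apply: paley_autM; apply: paley_autX.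
  by left; split; apply: val_inj; rewrite /= wE inordK.
exists (db ^+ b * sh ^+ j.-1)%g; first by apply: paley_autM; apply: paley_autX.
by right; split; apply: val_inj; rewrite /= wE inordK.
Qed.

Lemma low_wt_perm s y : paley_aut s -> low_wt y -> low_wt (\row_i y 0 (s i)).
Proof.
move=> sa.
have wt_s (u : 'rV['F_3]_24) : wt (\row_i u 0 (s i)) = wt u.
  by rewrite /wt [RHS](reindex_inj (@perm_inj _ s)); apply: eq_bigr => i _; rewrite mxE.
have paley3E i j : paley3 i j = (paley i j)%:~R by rewrite mxE.
have mulE : (\row_i y 0 (s i)) *m paley3 = \row_i (y *m paley3) 0 (s i).
  apply/rowP => j; rewrite [LHS]mxE [RHS]mxE [RHS]mxE [RHS](reindex_inj (@perm_inj _ s)).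
  by apply: eq_bigr => i _; rewrite [in LHS]mxE !paley3E sa.
by rewrite /low_wt mulE -!wt_eq0 !wt_s.
Qed.

(** Of at least three nonzero entries two lie at finite points, and a symmetry moves these to the
    indices 1 and 2. *)
Lemma paley_code_half y : low_wt y -> False.
Proof.
move=> low; have y2 := low_wt3 low.
pose S := [set i | (y 0 i != 0) && (i != 0)].
have : (1 < #|S|)%N.
  move: y2; rewrite /wt (bigD1 0) //= -sum1_card.
  have -> : (\sum_(i < 24 | i != ord0) (y 0%R i != 0%R) = \sum_(i in S) 1)%N.
    rewrite big_mkcond [RHS]big_mkcond; apply: eq_bigr => i _; rewrite inE.
    by case: (y 0 i != 0); case: (i != 0).
  by case: (_ != _) => /=; lia.
move=> /card_gt1P[i [j [+ + ij]]]; rewrite !inE => /andP[yi i0] /andP[yj j0].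
have [s sa sij] := paley_aut_pair i0 j0 ij.
by case: sij => -[s1 s2]; apply: (low_wt12 (low_wt_perm sa low)); rewrite mxE ?s1 ?s2.
Qed.

(** In a word of weight at most 12 one half has weight at most 6, and y -> yM exchanges the halves
    since M^2 = 1 over F_3. *)
Theorem paley_code_min_wt y : y != 0 -> (12 < wt y + wt (y *m paley3)%R)%N.
Proof.
move=> y0; rewrite ltnNge; apply/negP => tot.
have [y6|y6] := leqP (wt y) 6; first by apply: (@paley_code_half y); rewrite /low_wt y0 y6.
apply: (@paley_code_half (y *m paley3)); rewrite /low_wt -mulmxA paley3_sqr mulmx1 addnC tot andbT.
apply/andP; split; last first.
  by rewrite -(leq_add2l (wt y)) (leq_trans tot) // (leq_add2r 6 6) ltnW.
by apply: contraNneq y0 => e; rewrite -[y]mulmx1 -paley3_sqr mulmxA e mul0mx.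
Qed.

(** * Words of full weight *)

Definition codeword (y : 'rV['F_3]_24) : 'rV['F_3]_(24 + 24) := row_mx y (y *m paley3).
Definition zeros n (c : 'rV['F_3]_n) : {set 'I_n} := [set i | c 0 i == 0].

Lemma card_zeros n (c : 'rV['F_3]_n) : #|zeros c| = (n - wt c)%N.
Proof.
suff : (#|zeros c| + wt c)%N = n by move=> e; rewrite -[X in (X - _)%N]e addnK.
rewrite -[RHS]card_ord -(cardC (mem (zeros c))); congr (_ + _)%N.
by rewrite /wt -sum1_card [RHS]big_mkcond; apply: eq_bigr => i _; rewrite !inE; case: eqP.
Qed.

Lemma codeword_wt y : y != 0 -> (12 < wt (codeword y))%N.
Proof. by move/paley_code_min_wt; rewrite wt_row_mx. Qed.

(** Nonzero squares in F_3 are 1, so the weight modulo 3 is the product of a word with itself, which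
    vanishes. *)
Lemma codeword_wt3 y : (3 %| wt (codeword y))%N.
Proof.
have := dot_code_word paley3_mul_tr y y; rewrite -/(codeword y).
rewrite dotE; under eq_bigr => i _.
  have -> : codeword y 0 i * codeword y 0 i = ((codeword y 0 i != 0) : nat)%:R.
    by case: (F3P (codeword y 0 i)) => ->; apply/eqP.
over.
rewrite -natr_sum => /eqP; rewrite -/(wt _); move: (wt _) => w.
by rewrite -[X in _ == X]/(0%:R : 'F_3) -val_eqE /= !val_Fp_nat // mod0n.
Qed.

(* At most 12 columns of the generator matrix are independent, since the code is self-dual of minimum weight above 12. *)
Lemma card_codewords_zero (J : {set 'I_(24 + 24)}) : (#|J| <= 12)%N ->
  #|[set y | J \subset zeros (codeword y)]| = (3 ^ (24 - #|J|))%N.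
Proof.
move=> J12.
pose G : 'M['F_3]_(24, 24 + 24) := row_mx 1%:M paley3.
pose S : 'M['F_3]_(#|J|, 24 + 24) := \matrix_a delta_mx 0 (enum_val a).
have mulS m (X : 'M_(m, 24 + 24)) i a : (X *m S^T) i a = X i (enum_val a).
  rewrite mxE (bigD1 (enum_val a)) //= !mxE !eqxx mulr1 big1 ?addr0 // => j ja.
  by rewrite !mxE (negPf ja) andbF mulr0.
have codeE y : codeword y = y *m G by rewrite mul_mx_row mulmx1.
have free : row_free (S *m G^T).
  apply: inj_row_free => w; rewrite mulmxA => wG.
  pose u := w *m S; have wS a : u 0 (enum_val a) = w 0 a.
    rewrite mxE (bigD1 a) //= !mxE !eqxx mulr1 big1 ?addr0 // => b ba.
    by rewrite !mxE (inj_eq enum_val_inj) eq_sym (negPf ba) andbF mulr0.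
  have uJ i : i \notin J -> u 0 i = 0.
    move=> iJ; rewrite mxE big1 // => a _; rewrite !mxE eqxx /=.
    by case: eqP iJ => [->|]; rewrite ?mulr0 // enum_valP.
  have wt_u : (wt u <= 12)%N.
    apply: leq_trans J12; rewrite -sum1_card [leqRHS]big_mkcond /=; apply: leq_sum => i _.
    by case: ifP => [_|/negbT /uJ ->]; rewrite ?leq_b1 ?eqxx.
  (* By [wG], u is orthogonal to the code, hence a word of it, and too light to be nonzero. *)
  have u_code : u = codeword (rsubmx u *m paley3).
    rewrite /codeword -mulmxA paley3_sqr mulmx1 -[LHS]hsubmxK; congr row_mx.
    move: wG; rewrite -/u -[u]hsubmxK tr_row_mx mul_row_col trmx1 mulmx1 paley3_tr mulmxN row_mxKr row_mxKl.
    by move/eqP; rewrite subr_eq0 => /eqP.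
  have u0 : u = 0.
    have [|/codeword_wt] := eqVneq (rsubmx u *m paley3) 0; last by rewrite -u_code ltnNge wt_u.
    by move=> e; rewrite u_code e /codeword mul0mx row_mx0.
  by apply/rowP => a; rewrite -wS u0 !mxE.
have -> : [set y | J \subset zeros (codeword y)] = rowg (kermx (G *m S^T)).
  apply/setP => y; rewrite inE mem_rowg; apply/subsetP/sub_kermxP => [yJ|y0 i iJ].
    apply/rowP => a; rewrite mulmxA -codeE mulS [RHS]mxE.
    by have := yJ _ (enum_valP a); rewrite inE => /eqP.
  rewrite inE codeE -(enum_rankK_in iJ iJ) -mulS -mulmxA y0.
  by rewrite mxE.
by rewrite card_rowg card_Fp // mxrank_ker -[G]trmxK -trmx_mul mxrank_tr (eqP free).
Qed.

(** Double counting of the pairs of a word and a j-set of its zeros. *)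
Lemma sum_bin_zeros j : (j <= 12)%N ->
  (\sum_y 'C(#|zeros (codeword y)|, j) = 'C(48, j) * 3 ^ (24 - j))%N.
Proof.
move=> j12.
have -> : (\sum_y 'C(#|zeros (codeword y)|, j) =
           \sum_(y : 'rV['F_3]_24) \sum_(J : {set 'I_(24 + 24)} | #|J| == j) (J \subset zeros (codeword y)))%N.
  apply: eq_bigr => y _; rewrite -cards_draws -sum1dep_card big_mkcond [RHS]big_mkcond.
  by apply: eq_bigr => J _; case: (_ \subset _); case: (_ == _).
have -> : 'C(48, j) = #|[set J : {set 'I_(24 + 24)} | J \subset setT & #|J| == j]|.
  by rewrite cards_draws cardsT card_ord.
rewrite exchange_big -sum_nat_const big_mkcond [RHS]big_mkcond.
apply: eq_bigr => J _; rewrite inE subsetT /=; case: eqP => // Jj.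
by rewrite -Jj -card_codewords_zero ?Jj // -sum1dep_card [RHS]big_mkcond.
Qed.

Local Notation Z := BinNums.Z.

(** Rows of Pascal's triangle cut to 12 entries, enough for a polynomial of degree 11; binary
    integers keep the evaluation fast. *)
Fixpoint pascal (n : nat) : seq Z :=
  if n is n'.+1 then let r := pascal n' in pairmap +%R 0 r else 1 :: nseq 11 0.

Lemma size_pascal n : size (pascal n) = 12.
Proof. by elim: n => //= n IH; rewrite size_pairmap. Qed.

Lemma pascalE n j : (j < 12)%N -> nth 0 (pascal n) j = ('C(n, j))%:R.
Proof.
elim: n j => [|n IH] j j12; first by move: j12; do 12 case: j => [//|j].
rewrite [pascal _]/= (nth_pairmap 0) ?size_pascal //.
case: j j12 => [|j] j12 /=; first by rewrite IH // !bin0 add0r.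
by rewrite !IH ?(ltnW j12) // binS natrD addrC.
Qed.

(* The coefficients of (n - 3)(n - 6)...(n - 33) in the basis of binomial coefficients in n. *)
Definition newton : seq Z := Eval vm_compute in
  let values := mkseq (fun n => foldr (fun i p => (n%:R - (3 * i)%:R) * p) (1 : Z) (iota 1 11)) 12 in
  mkseq (fun j => head 0 (iter j (fun s => behead (pairmap (fun a b => b - a) 0 s)) values)) 12.

Definition newton_eval (n : nat) : Z :=
  foldr +%R 0 (map (fun p => p.1 * p.2) (zip newton (pascal n))).

Lemma foldr_sum (V : nmodType) (s : seq V) : foldr +%R 0 s = \sum_(x <- s) x.
Proof. by elim: s => [|x s IH]; rewrite ?big_nil // big_cons /= IH. Qed.

Lemma newton_evalE n : newton_eval n = \sum_(j < 12) nth 0 newton j * ('C(n, j))%:R.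
Proof.
rewrite /newton_eval foldr_sum big_map (big_nth (0, 0)) size_zip size_pascal minnn big_mkord.
by apply: eq_bigr => j _; rewrite nth_zip ?size_pascal //= pascalE.
Qed.

Definition full_words := [set y | wt (codeword y) == 48].

(** A nonzero word has weight 15, 18, ..., 48, hence 33, 30, ..., 0 zeros. Only the zero word and
    the words without zeros survive. *)
Lemma sum_zeros (V : zmodType) (f : nat -> V) : (forall q, (0 < q < 12)%N -> f (q * 3)%N = 0) ->
  \sum_y f #|zeros (codeword y)| = f 48 + f 0 *+ #|full_words|.
Proof.
move=> f0.
have wt0 : wt (codeword 0) = 0%N.
  by rewrite /codeword mul0mx row_mx0 /wt big1 // => i _; rewrite mxE eqxx.
rewrite (bigD1 0) //=; congr (_ + _); first by rewrite card_zeros wt0.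
rewrite (bigID (mem full_words)) /= addrC big1 ?add0r => [|y /andP[y0]].
  rewrite -sumr_const [RHS]big_mkcond [LHS]big_mkcond; apply: eq_bigr => y _; rewrite andbC.
  case: (eqVneq y 0) => [->|_]; first by rewrite andbF inE wt0.
  by rewrite andbT inE card_zeros; case: eqP => // ->.
rewrite inE card_zeros => w48; have := codeword_wt y0; have /dvdnP[q wq] := codeword_wt3 y.
have := wt_le (codeword y); rewrite wq in w48 *; move=> w_le w_gt.
by rewrite (_ : (24 + 24 - q * 3 = (16 - q) * 3)%N) ?f0 //; lia.
Qed.

Lemma card_full_words_of (V : numDomainType) (f : nat -> V) n :
    (forall q, (0 < q < 12)%N -> f (q * 3)%N = 0) -> f 0 != 0 ->
  \sum_y f #|zeros (codeword y)| = f 48 + f 0 * n%:R -> #|full_words| = n.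
Proof.
move=> roots f0; rewrite sum_zeros // => /addrI e.
by apply/eqP; rewrite -(eqr_nat V); apply/eqP/(mulfI f0); rewrite mulr_natr; exact: e.
Qed.

Lemma newton_roots : all (fun q => newton_eval (q * 3) == 0) (iota 1 11).
Proof. tab_check. Qed.

Lemma newton_count : foldr +%R 0 (map (fun j => nth 0 newton j * (nth 0 (pascal 48) j * 3 ^+ (24 - j))) (iota 0 12))
  == newton_eval 48 + newton_eval 0 * 96.
Proof. tab_check. Qed.

Lemma newton_eval0 : newton_eval 0 != 0.
Proof. tab_check. Qed.

(** The polynomial with roots 3, 6, ..., 33 is summed over all words in two ways: through binomial
    moments and through its roots. *)
Lemma card_full_words : #|full_words| = 96.
Proof.
have e : \sum_y newton_eval #|zeros (codeword y)| =
       \sum_(j < 12) nth 0 newton j * (('C(48, j))%:R * 3 ^+ (24 - j)).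
  under eq_bigr => y _ do rewrite newton_evalE.
  rewrite exchange_big; apply: eq_bigr => j _; rewrite -mulr_sumr -natr_sum.
  by rewrite sum_bin_zeros ?natrM ?natrX // ltnW // ltnW // ltnS ltnW.
have count : \sum_(j < 12) nth 0 newton j * (('C(48, j))%:R * 3 ^+ (24 - j)) =
    newton_eval 48 + newton_eval 0 * 96.
  rewrite -(eqP newton_count) foldr_sum big_map -[iota _ _]/(index_iota 0 12) big_mkord.
  by apply: eq_bigr => j _; rewrite pascalE.
have roots q : (0 < q < 12)%N -> newton_eval (q * 3) = 0.
  by move=> q12; apply/eqP; move/allP: newton_roots; apply; rewrite mem_iota.
by apply: (card_full_words_of roots newton_eval0); rewrite e.
Qed.

(** * The Hadamard frame *)

Definition red3 m n : 'M[int]_(m, n) -> 'M['F_3]_(m, n) := map_mx intr.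

Lemma intr_F3_eq0 (z : int) : ((z%:~R : 'F_3) == 0) = (3 %| z)%Z.
Proof. by rewrite (@dvdz_pcharf 'F_3 3) // pchar_Fp. Qed.

Lemma red3_eqP m n (u v : 'M[int]_(m, n)) :
  reflect (forall i j, (3 %| u i j - v i j)%Z) (red3 u == red3 v).
Proof.
apply: (iffP eqP) => [uv i j|uv].
  by rewrite -intr_F3_eq0 intrB; move/matrixP/(_ i j): uv; rewrite !mxE => ->; rewrite subrr.
by apply/matrixP => i j; rewrite !mxE; apply/eqP; rewrite -subr_eq0 -intrB intr_F3_eq0.
Qed.

Lemma dot_red3 n (u v : 'rV[int]_n) : dot (red3 u) (red3 v) = (dot u v)%:~R.
Proof. by rewrite !dotE rmorph_sum; apply: eq_bigr => i _; rewrite !mxE rmorphM. Qed.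

Definition in_code3 (h : 'rV[int]_(24 + 24)) := red3 h == codeword (lsubmx (red3 h)).

Lemma in_code3E (y z : 'rV[int]_24) : in_code3 (row_mx y z) = (red3 z == red3 y *m paley3).
Proof.
rewrite /in_code3 /red3 map_row_mx row_mxKl /codeword.
by apply/eqP/eqP => [/eq_row_mx[]|->].
Qed.

Lemma in_code3_word h : in_code3 h -> red3 h = codeword (lsubmx (red3 h)).
Proof. by move/eqP. Qed.

Lemma in_code3D h g : in_code3 h -> in_code3 g -> in_code3 (h + g).
Proof.
move=> /eqP hE /eqP gE; apply/eqP; rewrite /red3 map_mxD -!/(red3 _) hE gE /codeword.
by rewrite add_row_mx -mulmxDl !row_mxKl.
Qed.

Lemma in_code3Z a h : in_code3 h -> in_code3 (a *: h).
Proof.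
move=> /eqP hE; apply/eqP; rewrite /red3 map_mxZ -!/(red3 _) hE /codeword.
by rewrite scale_row_mx scalemxAl !row_mxKl.
Qed.

(** Since M^2 = 1 modulo 3, (1 + M)M = 1 + M and (1 - M)M = -(1 - M), so the rows reduce to
    codewords. *)
Definition hadamard : 'M[int]_(24 + 24) :=
  block_mx (1%:M + paley) (1%:M + paley) (1%:M - paley) (- (1%:M - paley)).

Lemma paley_sqr : paley *m paley = - 23%:M.
Proof. by apply: oppr_inj; rewrite -mulmxN -paley_tr paley_mul_tr opprK. Qed.

Lemma hadamard_mul_tr : hadamard *m hadamard^T = 48%:M.
Proof.
have sMD (a b : int) : a%:M + b%:M = (a + b)%:M :> 'M_24 by rewrite raddfD.
have trD : (1%:M + paley)^T = 1%:M - paley by rewrite linearD /= trmx1 paley_tr.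
have trB : (1%:M - paley)^T = 1%:M + paley by rewrite linearB /= trmx1 paley_tr opprK.
have mulDB : (1%:M + paley) *m (1%:M - paley) = 24%:M.
  rewrite mulmxBr mulmx1 mulmxDl mul1mx paley_sqr opprD addrA addrK opprK.
  by rewrite sMD.
have mulBD : (1%:M - paley) *m (1%:M + paley) = 24%:M.
  rewrite mulmxDr mulmx1 mulmxBl mul1mx paley_sqr opprK addrA subrK.
  by rewrite sMD.
rewrite /hadamard tr_block_mx; move: trD trB mulDB mulBD.
move: (1%:M + paley) (1%:M - paley) => A B AT BT AB BA.
have NT : (- B)^T = - A by rewrite -BT; apply/matrixP => i j; rewrite !mxE.
rewrite NT AT BT mulmx_block !mulmxN !mulNmx opprK AB BA !subrr.
by rewrite !sMD -scalar_mx_block.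
Qed.

Lemma hadamard_sign i j : hadamard i j = 1 \/ hadamard i j = -1.
Proof.
have chk : tab_all2 (fun i j a _ => a \in if i == j then [:: 0] else [:: 1; -1]) paley_tab paley_tab by tab_check.
have e (a b : 'I_24) : (1%:M + paley) a b \in [:: 1; -1] /\ (1%:M - paley) a b \in [:: 1; -1].
  have := tab_all2P a b chk; clear chk; rewrite !mxE val_eqE.
  by case: (a == b); rewrite !inE; [move/eqP => -> | move/orP => [] /eqP ->].
have sgn (x : int) : x \in [:: 1; -1] -> (x = 1 \/ x = -1) /\ (- x = 1 \/ - x = -1).
  by rewrite !inE => /orP[] /eqP ->; split; [left|right|right|left].
case: (split_ordP i) => a ->; case: (split_ordP j) => b ->.
- by rewrite block_mxEul; have [/sgn[]] := e a b.
- by rewrite block_mxEur; have [/sgn[]] := e a b.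
- by rewrite block_mxEdl; have [_ /sgn[]] := e a b.
- by rewrite block_mxEdr mxE; have [_ /sgn[]] := e a b.
Qed.

Lemma hadamard_code i : in_code3 (row i hadamard).
Proof.
have sqr : red3 paley *m paley3 = 1%:M by exact: paley3_sqr.
have redD (X Y : 'M[int]_24) : red3 (X + Y) = red3 X + red3 Y by exact: map_mxD.
have red1 : red3 1%:M = 1%:M :> 'M_24 by exact: map_mx1.
have redN (X : 'M[int]_24) : red3 (- X) = - red3 X by exact: map_mxN.
have redr (X : 'M[int]_24) a : red3 (row a X) = row a (red3 X) by exact: map_row.
case: (split_ordP i) => a ->.
  rewrite rowKu row_row_mx in_code3E !redr -row_mul redD red1 mulmxDl mul1mx sqr.
  by rewrite addrC.
rewrite rowKd row_row_mx in_code3E !redr -row_mul !redN redD red1 redN mulmxDl mul1mx mulNmx sqr.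
by rewrite opprB addrC.
Qed.

Definition signs n (h : 'rV[int]_n) := forall i, h 0 i = 1 \/ h 0 i = -1.

Lemma signs_red3_inj n (h g : 'rV[int]_n) : signs h -> signs g -> red3 h = red3 g -> h = g.
Proof.
move=> hs gs e; apply/rowP => i; move/matrixP/(_ 0 i): e; rewrite !mxE => e.
have := intr_F3_eq0 (h 0 i - g 0 i); rewrite intrB e subrr eqxx.
by case: (hs i) => ->; case: (gs i) => ->.
Qed.

Lemma signs_wt n (h : 'rV[int]_n) : signs h -> wt (red3 h) = n.
Proof.
move=> hs; rewrite -[RHS]card_ord -sum1_card; apply: eq_bigr => i _.
by rewrite mxE; case: (hs i) => ->.
Qed.

(** The 96 signed rows have distinct reductions, all of full weight, so they exhaust the 96 such
    words. *)
Lemma full_word_hadamard h : signs h -> in_code3 h ->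
  exists i, h = row i hadamard \/ h = - row i hadamard.
Proof.
pose w (p : 'I_(24 + 24) * bool) := (-1) ^+ p.2 *: row p.1 hadamard.
have w_signs p : signs (w p).
  move=> j; have -> : w p 0 j = (-1) ^+ p.2 * hadamard p.1 j by rewrite mxE [X in _ * X]mxE.
  by case: p => i [] /=; case: (hadamard_sign i j) => ->; rewrite ?expr1 ?expr0; [right|left|left|right].
have w_code p : in_code3 (w p) by apply/in_code3Z/hadamard_code.
pose f p := lsubmx (red3 (w p)).
have full g : signs g -> in_code3 g -> lsubmx (red3 g) \in full_words.
  by move=> gs /in_code3_word gc; rewrite inE -gc signs_wt.
have f_inj : injective f.
  move=> p q fpq; have wpq : w p = w q.
    apply: signs_red3_inj => //; rewrite (in_code3_word (w_code p)) (in_code3_word (w_code q)).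
    by rewrite -!/(f _) fpq.
  have dotw : dot (w p) (row q.1 hadamard) = (-1) ^+ q.2 * 48.
    by rewrite wpq dotZl dot_rowr -row_mul hadamard_mul_tr !mxE eqxx.
  have := dotw; rewrite dotZl dot_rowr -row_mul hadamard_mul_tr !mxE.
  case: p q {fpq wpq dotw} => i b [j c] /=; case: eqP => [->|_].
    by case: b; case: c.
  by rewrite mulr0n mulr0; case: c.
have f_onto : f @: setT = full_words.
  apply/eqP; rewrite eqEcard card_full_words card_imset // cardsT card_prod card_ord card_bool.
  by rewrite andbT; apply/subsetP => _ /imsetP[p _ ->]; exact: full.
move=> hs hc; have := full h hs hc; rewrite -f_onto => /imsetP[[i b] _ hf].
have -> : h = w (i, b).
  by apply: signs_red3_inj => //; rewrite (in_code3_word hc) (in_code3_word (w_code _)) hf.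
by exists i; rewrite /w; case: b {hf}; rewrite /= ?expr1 ?expr0 ?scale1r ?scaleN1r; [right|left].
Qed.

(** * The even unimodular neighbours *)

Lemma sum_centered n (h g : 'rV[int]_n) a b :
  \sum_i (h 0 i - a) * (g 0 i - b) =
  dot h g - b * (\sum_i h 0 i) - a * (\sum_i g 0 i) + n%:Z * (a * b).
Proof.
have -> : n%:Z * (a * b) = \sum_(i < n) a * b by rewrite sumr_const card_ord -mulr_natl natz.
rewrite dotE !mulr_sumr -!sumrB -big_split.
by apply: eq_bigr => i _ /=; ring.
Qed.

Lemma dvd2_consecutive (q : int) : (2 %| q * (q + 1))%Z.
Proof.
have [r [->|->]] : exists r, q = r * 2 \/ q = r * 2 + 1 by exists (q %/ 2)%Z; lia.
  by rewrite -mulrA dvdz_mull // dvdz_mulr.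
by apply: dvdz_mull; apply/dvdzP; exists (r + 1); ring.
Qed.

Section Parity.
Variables (h g : 'rV[int]_(24 + 24)) (a b : int).
Hypotheses (ha : forall i, (2 %| h 0%R i - a)%Z) (gb : forall i, (2 %| g 0%R i - b)%Z).

(** Expand the sum of (h_i - a)(g_i - b), whose terms are products of two even numbers; 4 divides
    48. *)
Lemma dot_mod4 : (4 %| dot h g - b * (\sum_i h 0%R i) - a * (\sum_i g 0%R i))%Z.
Proof.
have : (4 %| \sum_i (h 0%R i - a) * (g 0%R i - b))%Z.
  by apply: rpred_sum => i _; apply: (@dvdz_mul 2 2); rewrite ?ha ?gb.
by rewrite sum_centered; lia.
Qed.

(** Expand the sum of (h_i - a)(h_i - a - 2), whose terms are products of consecutive even numbers;
    8 divides 48. *)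
Lemma dot_mod8 : (8 %| dot h h - 2 * (1 + a) * (\sum_i h 0%R i))%Z.
Proof.
have : (8 %| \sum_i (h 0%R i - a) * (h 0%R i - (a + 2)))%Z.
  apply: rpred_sum => i _; have /dvdzP[q hq] := ha i.
  rewrite opprD addrA hq (_ : _ * _ = 4 * (q * (q - 1))); last by ring.
  have /dvdzP[p e] := dvd2_consecutive (q - 1).
  have -> : q * (q - 1) = p * 2 by rewrite -e; ring.
  by apply/dvdzP; exists p; ring.
rewrite sum_centered; set S := \sum_i _; set D := dot h h => /dvdzP[q e]; apply/dvdzP.
by exists (q - 6 * (a * (a + 2))); rewrite (_ : D = q * 8 + (a + 2) * S + a * S - (24 + 24)%:Z * (a * (a + 2))); [ring | rewrite -e; ring].
Qed.
End Parity.

Definition i0 : 'I_(24 + 24) := lshift 24 0.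

(* With the scalar product [dot h g / 12], the lattices [lat true] and [lat false] are the even unimodular neighbours of the
   odd unimodular lattice [{2 x | x mod 3 in the Pless code}], the former being extremal. *)
Definition lat (s : bool) (h : 'rV[int]_(24 + 24)) : bool :=
  [&& [forall i, (2 %| h 0%R i - h 0%R i0)%Z], (4 %| \sum_i h 0%R i - s.*2%:Z * h 0%R i0)%Z & in_code3 h].

Lemma latP s h : lat s h -> [/\ forall i, (2 %| h 0%R i - h 0%R i0)%Z,
  (4 %| \sum_i h 0%R i - s.*2%:Z * h 0%R i0)%Z & in_code3 h].
Proof. by move=> /and3P[/forallP]. Qed.

Lemma lat_dvd3 h g : in_code3 h -> in_code3 g -> (3 %| dot h g)%Z.
Proof.
by move=> /in_code3_word hc /in_code3_word gc; rewrite -intr_F3_eq0 -dot_red3 hc gc dot_code_word ?paley3_mul_tr.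
Qed.

Lemma lat_int s h g : lat s h -> lat s g -> (12 %| dot h g)%Z.
Proof.
move=> /latP[hp /dvdzP[u hs] hc] /latP[gp /dvdzP[v gs] gc].
have := lat_dvd3 hc gc; have /dvdzP[w e] := dot_mod4 hp gp.
move: (h 0 i0) (g 0 i0) hs gs e => a b; set Sh := \sum_i _; set Sg := \sum_i _ => hs gs e.
suff /dvdzP[q ->] : (4 %| dot h g)%Z by lia.
apply/dvdzP; exists (w + b * u + a * v + s%:Z * (a * b)).
have -> : dot h g = w * 4 + b * (u * 4 + s.*2%:Z * a) + a * (v * 4 + s.*2%:Z * b).
  by rewrite -hs -gs -e; ring.
by rewrite -muln2 PoszM; ring.
Qed.

Lemma lat_even s h : lat s h -> (24 %| dot h h)%Z.
Proof.
move=> /latP[hp /dvdzP[u hs] hc]; have := lat_dvd3 hc hc; have /dvdzP[w e] := dot_mod8 hp.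
move: (h 0 i0) hs e => a; set Sh := \sum_i _ => hs e.
have /dvdzP[t at2] := dvd2_consecutive a.
suff /dvdzP[q ->] : (8 %| dot h h)%Z by lia.
apply/dvdzP; exists (w + (1 + a) * u + s%:Z * t).
have -> : dot h h = w * 8 + 2 * (1 + a) * (u * 4 + s.*2%:Z * a) by rewrite -hs -e; ring.
rewrite -muln2 PoszM (_ : _ + _ = w * 8 + (1 + a) * u * 8 + 4 * s%:Z * (a * (a + 1))); last by ring.
by rewrite at2; ring.
Qed.

(** For i other than [i0], a vector of norm 72 / 12 = 6. Its product with h tests the parity of h_i
    - h_0. *)
Definition six_vec (i : 'I_(24 + 24)) : 'rV[int]_(24 + 24) := 6 *: (delta_mx 0 i0 + delta_mx 0 i).

Lemma dot_six h i : dot h (six_vec i) = 6 * (h 0 i0 + h 0 i).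
Proof. by rewrite dotC dotZl dotDl ![dot (delta_mx _ _) _]dotC !dot_delta. Qed.

Lemma six_vecE i j : six_vec i 0 j = 6 * ((j == i0)%:R + (j == i)%:R).
Proof. by rewrite !mxE. Qed.

Lemma sum_dot_const n (h : 'rV[int]_n) : \sum_i h 0 i = dot h (const_mx 1).
Proof. by rewrite dotE; apply: eq_bigr => i _; rewrite mxE mulr1. Qed.

Lemma in_code3_mul3 h : in_code3 (3 *: h).
Proof.
have red0 : red3 (3 *: h) = 0.
  apply/eqP; rewrite -(_ : red3 0 = 0); last by rewrite /red3 map_mx0.
  by apply/red3_eqP => a b; rewrite !mxE subr0 dvdz_mulr.
by rewrite /in_code3 red0 linear0 /codeword mul0mx row_mx0.
Qed.

Lemma lat_six s i : lat s (six_vec i).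
Proof.
apply/and3P; split.
- by apply/forallP => j; rewrite !six_vecE -mulrBr dvdz_mulr.
- rewrite sum_dot_const dotC dot_six six_vecE eqxx !mxE; case: s; case: (_ == _); rewrite /=; lia.
- have -> : six_vec i = 3 *: (2 *: (delta_mx 0 i0 + delta_mx 0 i)) by rewrite scalerA.
  exact: in_code3_mul3.
Qed.

Lemma red3_surj m n (y : 'M['F_3]_(m, n)) : exists u, y = red3 u.
Proof.
exists (\matrix_(i, j) (nat_of_ord (y i j))%:Z); apply/matrixP => i j; rewrite !mxE.
by rewrite -[RHS]/((nat_of_ord (y i j))%:R) natr_Zp.
Qed.

Lemma row0_hadamard : row i0 hadamard = const_mx 1.
Proof.
have chk : tab_all2 (fun i j a _ => (i == 0%N) ==> ((i == j)%:R + a == 1)) paley_tab paley_tab by tab_check.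
have e (j : 'I_24) : (1%:M + paley) 0 j = 1.
  by have /eqP e := tab_all2P 0 j chk; rewrite -[RHS]e [LHS]mxE [X in X + _]mxE -val_eqE.
apply/rowP => j; rewrite [RHS]mxE mxE /i0.
by case: (split_ordP j) => l ->; rewrite ?block_mxEul ?block_mxEur e.
Qed.

(** The all-one vector; for [lat true] its first entry becomes -5, which keeps the residues modulo 2
    and 3 and corrects the sum modulo 4. *)
Definition odd_vec (s : bool) : 'rV[int]_(24 + 24) := const_mx 1 - (s : nat)%:Z *: (6 *: delta_mx 0 i0).

Lemma odd_vecE s j : odd_vec s 0 j = 1 - s%:Z * (6 * (j == i0)%:R).
Proof. by rewrite !mxE. Qed.

Lemma lat_odd s : lat s (odd_vec s).
Proof.
apply/and3P; split.
- by apply/forallP => j; rewrite !odd_vecE eqxx; case: s; case: (_ == _); rewrite /=; lia.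
- have -> : \sum_i odd_vec s 0 i = 48 - s%:Z * 6.
    under eq_bigr => i _ do rewrite odd_vecE.
    rewrite (bigD1 i0) //= ?eqxx (eq_bigr (fun=> 1)) => [|j /negPf ->]; last by rewrite !mulr0 subr0.
    by rewrite sumr_const cardC1 card_ord; case: s.
  by rewrite odd_vecE ?eqxx; case: s.
- have -> : odd_vec s = row i0 hadamard + 3 *: ((- s%:Z * 2) *: delta_mx 0 i0).
    by rewrite /odd_vec row0_hadamard !scalerA -scaleNr; congr (_ + _ *: _); ring.
  by apply: in_code3D; [exact: hadamard_code | exact: in_code3_mul3].
Qed.

Lemma lat_code s (y : 'rV[int]_24) : lat s (4 *: row_mx y (y *m paley)).
Proof.
set c := row_mx _ _; apply/and3P; split.
- by apply/forallP => j; rewrite !mxE -mulrBr; lia.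
- rewrite sum_dot_const dotZl mxE (_ : _ - _ = 4 * (dot c (const_mx 1) - s.*2%:Z * c 0 i0)) ?dvdz_mulr //.
  by ring.
- by apply: in_code3Z; rewrite in_code3E /red3 map_mxM.
Qed.

(** The vectors [six_vec], [odd_vec] and 4(y, yM) test the parity condition, the sum condition and
    the code condition in turn. *)
Lemma lat_dual s h : (forall g, lat s g -> (12 %| dot h g)%Z) -> lat s h.
Proof.
move=> dual; have par i : (2 %| h 0%R i - h 0%R i0)%Z.
  by have := dual _ (lat_six s i); rewrite dot_six; lia.
apply/and3P; split; first exact/forallP.
  have /latP[gp gs _] := lat_odd s; have := dual _ (lat_odd s); have := dot_mod4 par gp.
  move: gs; rewrite odd_vecE eqxx; move: (h 0 i0) (dot _ _) (\sum_i h 0 i) (\sum_i _) => a D S S'.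
  by case: s {dual gp}; rewrite /=; lia.
apply/eqP/(code_word_dual paley3_mul_tr) => y; have [u ->] := red3_surj y.
have -> : row_mx (red3 u) (red3 u *m paley3) = red3 (row_mx u (u *m paley)) by rewrite /red3 map_row_mx map_mxM.
apply/eqP; rewrite dot_red3 intr_F3_eq0.
by have := dual _ (lat_code s u); rewrite dotC dotZl dotC (@dvdz_mul2l 4 3).
Qed.

Lemma lat_dualP s h : lat s h <-> forall g, lat s g -> (12 %| dot h g)%Z.
Proof. by split=> [hl g|]; [exact: lat_int | exact: lat_dual]. Qed.

(** All norms are multiples of 24. If h vanishes modulo 3, 9 divides the norm too. If h is even, at
    least 15 entries have square at least 4. If h is odd, the norm exceeds 48 unless all entries are
    1 or -1. *)
Lemma lat_min s h : lat s h -> h != 0 -> 72 <= dot h h \/ signs h.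
Proof.
move=> hl h0; have h_gt0 := dot_gt0 h0; have even := lat_even hl; have /latP[par _ code] := hl.
have [r0|r0] := eqVneq (red3 h) 0.
  left; have h3 i : (3 %| h 0%R i)%Z by rewrite -intr_F3_eq0; move/rowP/(_ i): r0; rewrite !mxE => ->.
  have : (9 %| dot h h)%Z.
    by rewrite dotE; apply: rpred_sum => i _; apply: (@dvdz_mul 3 3); rewrite h3.
  by move: even h_gt0; lia.
have [a2|a1] := boolP (2 %| h 0%R i0)%Z.
  left; have w_ge : (15 <= wt (red3 h))%N.
    rewrite (in_code3_word code); have := codeword_wt3 (lsubmx (red3 h)).
    have [|/codeword_wt] := eqVneq (lsubmx (red3 h)) 0; last by lia.
    by move=> l0; move: r0; rewrite (in_code3_word code) l0 /codeword mul0mx row_mx0 eqxx.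
  have : 4 * (wt (red3 h))%:Z <= dot h h.
    rewrite dotE /wt (big_morph Posz PoszD (erefl 0%Z)) mulr_sumr; apply: ler_sum => i _.
    rewrite mxE intr_F3_eq0; case: (boolP (3 %| _)%Z) => /= hi; first by rewrite mulr0 -expr2 sqr_ge0.
    have /dvdzP[x hx] : (2 %| h 0%R i)%Z by have := par i; lia.
    rewrite hx in hi *; have [x0|x0] := eqVneq x 0; first by rewrite x0 mul0r dvdz0 in hi.
    by rewrite (_ : x * 2 * (x * 2) = 4 * (x * x)) ?ler_pM2l //; [nia | ring].
  by move: even; lia.
have odd i : h 0 i ^+ 2 >= 1 by have := par i; nia.
have [[i hi]|all1] : (exists i, h 0 i ^+ 2 != 1) \/ signs h.
  have [/forallP h1|/forallPn[i hi]] := boolP [forall i, h 0 i ^+ 2 == 1]; [right|by left; exists i].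
  by move=> i; have := h1 i; rewrite sqrf_eq1 => /orP[] /eqP; [left|right].
  left; have : 48 < dot h h.
    rewrite dotE (bigD1 i) //= -expr2; have : 47 <= \sum_(j < 24 + 24 | j != i) h 0 j * h 0 j.
      apply: le_trans (ler_sum _ (fun j _ => odd j)).
      by rewrite sumr_const cardC1 card_ord.
    by apply: (@ltr_leD _ 1 _ 47); rewrite lt_def hi odd.
  by move: even; lia.
by right.
Qed.

(** * Frames in the extremal lattice *)

(** Such a word is a signed row of [hadamard], and the rows have product 0 or 48 with the all-one
    row. *)
Lemma signs_sum_dvd4 h : signs h -> in_code3 h -> (4 %| \sum_i h 0%R i)%Z.
Proof.
have rows i : (4 %| \sum_j hadamard i j)%Z.
  have odd (a : 'I_(24 + 24)) j : (2 %| row a hadamard 0%R j - 1)%Z.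
    by rewrite mxE; case: (hadamard_sign a j) => ->.
  have /dvdzP[q] := dot_mod4 (odd i) (odd i0).
  rewrite dot_rowr -row_mul hadamard_mul_tr !mul1r row0_hadamard.
  rewrite [X in X - _ - _]mxE [X in X - _ - _]mxE (eq_bigr (hadamard i)) => [|j _]; last by rewrite mxE.
  rewrite (eq_bigr (fun=> 1) (F1 := const_mx 1 0)) => [|j _]; last by rewrite mxE.
  by rewrite sumr_const card_ord => e; case: (i == i0) e => /= e; lia.
move=> hs hc; have [i [->|->]] := full_word_hadamard hs hc.
  by rewrite (eq_bigr (hadamard i)) ?rows // => j _; rewrite mxE.
rewrite (eq_bigr (fun j => - hadamard i j)) => [|j _]; last by rewrite !mxE.
by rewrite sumrN dvdzE abszN -dvdzE rows.
Qed.

(** A vector of signs in [lat true] would have sum 2 modulo 4. *)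
Lemma lat_true_min h : lat true h -> h != 0 -> 72 <= dot h h.
Proof.
move=> hl h0; case: (lat_min hl h0) => // hs; have /latP[_ sum_h code] := hl.
have := signs_sum_dvd4 hs code; move: sum_h; case: (hs i0) => -> ; rewrite /=; lia.
Qed.

Lemma dot_six_self i : i != i0 -> dot (six_vec i) (six_vec i) = 72.
Proof. by move=> ii0; rewrite dot_six !six_vecE !eqxx eq_sym (negPf ii0). Qed.

Theorem frame_exists_code (k : nat) (F : 'M[int]_(24 + 24)) : (2 < k)%N ->
    (forall i, lat true (row i F)) -> F *m F^T = (12 * (2 * k))%:Z%:M ->
  exists C : {set 'rV['Z_(2 * k)]_48}, typeII C /\ extremal C.
Proof.
move=> k2 LF FF; have k0 : (0 < k)%N by lia.
pose i1 : 'I_(24 + 24) := lshift 24 (inord 1); pose i2 : 'I_(24 + 24) := lshift 24 (inord 2).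
have i10 : i1 != i0 by rewrite -val_eqE /= inordK.
have i20 : i2 != i0 by rewrite -val_eqE /= inordK.
have i12 : i1 != i2 by rewrite -val_eqE /= !inordK.
have six : exists2 h, lat true h & dot h h = (6 * 12)%:Z /\
    exists i, ~~ ((12 * (2 * k))%N %| dot h (row i F))%Z.
  have [all1|/forallPn ex1] := boolP [forall i, ((12 * (2 * k))%N %| dot (six_vec i1) (row i F))%Z]; last first.
    by exists (six_vec i1); [exact: lat_six | rewrite dot_six_self].
  have [all2|/forallPn ex2] := boolP [forall i, ((12 * (2 * k))%N %| dot (six_vec i2) (row i F))%Z]; last first.
    by exists (six_vec i2); [exact: lat_six | rewrite dot_six_self].
  (* If both vectors gave the zero codeword, (24k)^2 would divide 24k * 36, where 36 is their
     product; but 24k is at least 72. *)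
  exfalso; pose w i := six_vec i *m F^T.
  have dvd_w i : [forall j, ((12 * (2 * k))%N %| dot (six_vec i) (row j F))%Z] ->
      w i = (12 * (2 * k))%:Z *: map_mx (divz^~ (12 * (2 * k))%:Z) (w i).
    by move=> /forallP h; apply: dvd_rowP => j; rewrite -dot_rowr.
  have : dot (w i1) (w i2) = (12 * (2 * k))%:Z * 36.
    rewrite /dot trmx_mul trmxK mulmxA -[_ *m F^T *m F]mulmxA (mul_tr_scalarC _ FF) //; last by lia.
    rewrite mul_mx_scalar -scalemxAl mxE -/(dot _ _) dot_six !six_vecE !eqxx.
    by rewrite [i0 == _]eq_sym (negPf i10) (negPf i20) [i2 == _]eq_sym (negPf i12).
  rewrite (dvd_w _ all1) (dvd_w _ all2) dotZl dotC dotZl; move: (dot _ _) => t.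
  move=> /(mulfI _) e; have {e} := e _; rewrite -[36]/(36%:Z) => e.
  have {e} : (12 * (2 * k))%:Z * t = 36 by apply: e; lia.
  have : 72 <= (12 * (2 * k))%:Z by lia.
  by nia.
exists (@frame_code k (24 + 24) (lat true) F); split.
  exact: (@frame_code_typeII 12 k _ _ _ isT k0 (lat_dualP true) (@lat_even true) LF FF).
have wtE : (4 * k * (48 %/ 24) + 4 * k = 12 * k)%N by rewrite (_ : 48 %/ 24 = 2)%N //; lia.
rewrite /extremal wtE.
apply: (@frame_code_min 12 k _ _ _ isT k0 (lat_dualP true) LF FF _ six).
by move=> h hl h0 _; exact: lat_true_min.
Qed.

Theorem code_2 : exists C : {set 'rV['Z_(2 * 2)]_48}, typeII C /\ extremal C.
Proof.
have LF i : lat false (row i hadamard).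
  apply/and3P; split; last exact: hadamard_code.
  - apply/forallP => j; rewrite ![row _ _ _ _]mxE.
    by case: (hadamard_sign i j) => ->; case: (hadamard_sign i i0) => ->.
  - rewrite mul0r subr0; apply: signs_sum_dvd4; last exact: hadamard_code.
    by move=> j; rewrite mxE; exact: hadamard_sign.
have FF : hadamard *m hadamard^T = (12 * (2 * 2))%:Z%:M by exact: hadamard_mul_tr.
exists (@frame_code 2 (24 + 24) (lat false) hadamard); split.
  exact: (@frame_code_typeII 12 2 _ _ _ isT isT (lat_dualP false) (@lat_even false) LF FF).
apply: (@frame_code_min 12 2 _ _ _ isT isT (lat_dualP false) LF FF).
  (* The vectors of norm 4 are signed frame rows; their product 48 with a frame row exceeds the
     bound 24. *)
  move=> h hl h0 bound; case: (lat_min hl h0) => // hs; have /latP[_ _ hc] := hl.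
  have diag i : dot (row i hadamard) (row i hadamard) = 48.
    by rewrite dot_rowr -row_mul hadamard_mul_tr !mxE eqxx.
  have [i [hi|hi]] := full_word_hadamard hs hc; have := bound i; rewrite hi ?diag //.
  by rewrite -scaleN1r dotZl diag.
exists (six_vec (lshift 24 (inord 1))); first exact: lat_six.
split; first by rewrite dot_six_self // -val_eqE /= inordK.
by exists i0; rewrite dotC -[row _ _]/(row i0 _) dot_six row0_hadamard !mxE.
Qed.

(** * Lagrange's four-square theorem *)

Definition sum4sq (n : int) : Prop := exists a b c d : int, n = a ^+ 2 + b ^+ 2 + c ^+ 2 + d ^+ 2.

(** Euler's four-square identity. *)
Lemma sum4sqM m n : sum4sq m -> sum4sq n -> sum4sq (m * n).
Proof.
move=> [a [b [c [d ->]]]] [a' [b' [c' [d' ->]]]].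
exists (a * a' + b * b' + c * c' + d * d'), (a * b' - b * a' + c * d' - d * c').
by exists (a * c' - c * a' + d * b' - b * d'), (a * d' - d * a' + b * c' - c * b'); ring.
Qed.

(** Pigeonhole: the values x^2 and -1 - y^2 form two sets of (p + 1)/2 residues each, so they
    meet. *)
Lemma sqr_sum_mod_prime (p : nat) : prime p -> odd p ->
  exists x y : nat, [/\ (x.*2 < p)%N, (y.*2 < p)%N & (p %| x ^ 2 + y ^ 2 + 1)%N].
Proof.
move=> pp po; have p_gt1 := prime_gt1 pp.
have [h ph] : exists h, p = h.*2.+1 by exists p./2; rewrite -[LHS]odd_double_half po.
pose f (i : 'I_h.+1) : 'F_p := (i : nat)%:R ^+ 2.
have f_inj : injective f.
  move=> i j /eqP; rewrite -subr_eq0 subr_sqr mulf_eq0 => /orP[].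
    rewrite subr_eq0 -val_eqE /= !val_Fp_nat // !modn_small => [/eqP/val_inj //||].
      by have := ltn_ord j; lia.
    by have := ltn_ord i; lia.
  rewrite -natrD -val_eqE /= val_Fp_nat // modn_small => [|]; last first.
    by have := ltn_ord j; have := ltn_ord i; lia.
  by move=> /eqP ij; apply: val_inj; rewrite /=; lia.
pose g i := - 1 - f i.
have g_inj : injective g by move=> i j /addrI/oppr_inj/f_inj.
have : [set f i | i in 'I_h.+1] :&: [set g i | i in 'I_h.+1] != set0.
  apply/eqP => disj; have := cardsUI [set f i | i in 'I_h.+1] [set g i | i in 'I_h.+1].
  rewrite disj cards0 addn0 !card_imset // card_ord => e.
  have := max_card (mem ([set f i | i in 'I_h.+1] :|: [set g i | i in 'I_h.+1])).
  by rewrite e card_Fp //; lia.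
move=> /set0Pn[z /setIP[/imsetP[i _ ->] /imsetP[j _ fg]]].
exists i, j; split; [by have := ltn_ord i; lia | by have := ltn_ord j; lia|].
have : f i + f j + 1 == 0 by rewrite fg /g subrK addNr.
by rewrite /f -!natrX -natrD natr1 -val_eqE /= val_Fp_nat // addn1.
Qed.

Lemma centered_residue (m : nat) (x : int) : (0 < m)%N ->
  exists y t : int, x = y + m%:Z * t /\ `|y| *+ 2 <= m%:Z.
Proof.
move=> m0; have mn0 : m%:Z != 0 by lia.
have := divz_eq x m; have := ltz_mod x mn0; have := modz_ge0 x mn0.
move: (x %/ m)%Z (x %% m)%Z => q r r0; rewrite ger0_norm // => rm ->.
have [le|lt] := leP (r *+ 2) m%:Z; first by exists r, q; split; [ring | rewrite ger0_norm].
by exists (r - m%:Z), (q + 1); split; [ring | lia].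
Qed.

Lemma sqr_le_half (m y : int) : `|y| *+ 2 <= m -> y ^+ 2 *+ 4 <= m ^+ 2.
Proof.
move=> ym; rewrite -[y ^+ 2]real_normK ?num_real // (_ : _ *+ 4 = (`|y| *+ 2) ^+ 2); last by ring.
by apply: lerXn2r; rewrite // nnegrE ?(le_trans _ ym) // mulrn_wge0.
Qed.

Lemma four_le (M a b c d : int) : a *+ 4 <= M -> b *+ 4 <= M -> c *+ 4 <= M -> d *+ 4 <= M ->
  a + b + c + d <= M.
Proof. lia. Qed.

Lemma four_tight (M a b c d : int) : a *+ 4 <= M -> b *+ 4 <= M -> c *+ 4 <= M -> d *+ 4 <= M ->
  a + b + c + d = M -> [/\ a *+ 4 = M, b *+ 4 = M, c *+ 4 = M & d *+ 4 = M].
Proof. by move=> *; split; lia. Qed.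

Lemma sum4sq_descent (p m : nat) : prime p -> (1 < m < p)%N -> sum4sq (m * p)%N ->
  exists2 r, (0 < r < m)%N & sum4sq (r * p)%N.
Proof.
move=> pp /andP[m1 mp] [x0 [x1 [x2 [x3 xE]]]]; have m0 : (0 < m)%N := ltnW m1.
have m_neq1 : m != 1%N by rewrite gtn_eqF.
have mn0 : m%:Z != 0 by lia.
have [y0 [t0 [e0 b0]]] := centered_residue x0 m0; have [y1 [t1 [e1 b1]]] := centered_residue x1 m0.
have [y2 [t2 [e2 b2]]] := centered_residue x2 m0; have [y3 [t3 [e3 b3]]] := centered_residue x3 m0.
pose Y := y0 ^+ 2 + y1 ^+ 2 + y2 ^+ 2 + y3 ^+ 2.
pose YT := y0 * t0 + y1 * t1 + y2 * t2 + y3 * t3.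
pose TT := t0 ^+ 2 + t1 ^+ 2 + t2 ^+ 2 + t3 ^+ 2.
have mpE : m%:Z * p%:Z = Y + m%:Z * (2 * YT + m%:Z * TT).
  by rewrite -PoszM xE e0 e1 e2 e3 /Y /YT /TT; ring.
(* As 1 < m < p, m does not divide p; this rules out q = 0 and q = m. *)
have no_m2 q : m%:Z * p%:Z != m%:Z * (m%:Z * q).
  apply/eqP => /(mulfI mn0) e; have : (m%:Z %| p%:Z)%Z by rewrite e dvdz_mulr.
  by rewrite dvdzE => /(prime_nt_dvdP pp m_neq1) e'; rewrite e' ltnn in mp.
have [s0 s1 s2 s3] := And4 (sqr_le_half b0) (sqr_le_half b1) (sqr_le_half b2) (sqr_le_half b3).
have [q Yq] : exists q, Y = m%:Z * q by exists (p%:Z - (2 * YT + m%:Z * TT)); rewrite mulrBr mpE; ring.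
have q0 : 0 < q.
  have : 0 <= Y by rewrite /Y !addr_ge0 ?sqr_ge0.
  rewrite Yq pmulr_rge0 ?ltz_nat // le_eqVlt => /orP[/eqP q0|//].
  have : Y == 0 by rewrite Yq -q0 mulr0.
  rewrite /Y !paddr_eq0 ?addr_ge0 ?sqr_ge0 // !sqrf_eq0.
  move=> /andP[/andP[/andP[/eqP z0 /eqP z1] /eqP z2] /eqP z3].
  have /eqP[] := no_m2 TT; rewrite mpE Yq -q0 /YT z0 z1 z2 z3; ring.
have qm : q < m.
  have Ym : Y <= m%:Z ^+ 2 := four_le s0 s1 s2 s3.
  have : q <= m by move: Ym; rewrite Yq expr2 ler_pM2l // ltz_nat.
  rewrite le_eqVlt => /orP[/eqP qm|//].
  (* For q = m each y_i is m/2 up to sign, which would make mp a multiple of m^2. *)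
  have tight y : y ^+ 2 *+ 4 = m%:Z ^+ 2 -> exists e, 2 * y = m%:Z * e.
    move=> ye; have : (2 * y) ^+ 2 = m%:Z ^+ 2 by rewrite -ye; ring.
    by move/eqP; rewrite eqf_sqr => /orP[] /eqP ->; [exists 1|exists (-1)]; ring.
  have [|/tight[u0 h0] /tight[u1 h1] /tight[u2 h2] /tight[u3 h3]] := four_tight s0 s1 s2 s3.
    by rewrite -/Y Yq qm expr2.
  have /eqP[] := no_m2 (1 + (u0 * t0 + u1 * t1 + u2 * t2 + u3 * t3) + TT).
  have YTE : 2 * YT = m%:Z * (u0 * t0 + u1 * t1 + u2 * t2 + u3 * t3).
    rewrite /YT !mulrDr ![2 * (_ * _)]mulrA h0 h1 h2 h3; ring.
  by rewrite mpE Yq qm YTE; ring.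
exists `|q|%N; first by clear -q0 qm; lia.
have [w0 [w1 [w2 [w3 wE]]]] : exists w0 w1 w2 w3,
  (m%:Z * p%:Z) * Y = m%:Z ^+ 2 * (w0 ^+ 2 + w1 ^+ 2 + w2 ^+ 2 + w3 ^+ 2).
  (* Euler's identity for the x_i and y_i divided by m: the product of x with y is m(q + YT), and
     x_i y_j - x_j y_i = m(t_i y_j - t_j y_i). *)
  exists (q + YT), (t0 * y1 - t1 * y0 + t2 * y3 - t3 * y2).
  exists (t0 * y2 - t2 * y0 + t3 * y1 - t1 * y3), (t0 * y3 - t3 * y0 + t1 * y2 - t2 * y1).
  set W1 := t0 * y1 - _ + _ - _; set W2 := t0 * y2 - _ + _ - _; set W3 := t0 * y3 - _ + _ - _.
  rewrite (_ : _ * (_ + _) = (m%:Z * (q + YT)) ^+ 2 + m%:Z ^+ 2 * (W1 ^+ 2 + W2 ^+ 2 + W3 ^+ 2)); last by ring.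
  by rewrite [_ * (q + _)]mulrDr -Yq mpE /W1 /W2 /W3 /YT /TT /Y; ring.
exists w0, w1, w2, w3; rewrite PoszM gez0_abs ?ltW //.
have mm : m%:Z ^+ 2 != 0 by rewrite expf_neq0.
by apply: (mulfI mm); rewrite -wE Yq; ring.
Qed.

Lemma sum4sq_prime (p : nat) : prime p -> sum4sq p.
Proof.
move=> pp; have [->|p_neq2] := eqVneq p 2%N; first by exists 1, 1, 0, 0.
have po : odd p by case: (even_prime pp) p_neq2 => [->|].
have p1 := prime_gt1 pp.
(* Since x and y are below p/2, x^2 + y^2 + 1 is a multiple mp with m < p, where the descent
   starts. *)
have [m m_range mS] : exists2 m, (0 < m < p)%N & sum4sq (m * p)%N.
  have [x [y [xp yp /dvdnP[m mE]]]] := sqr_sum_mod_prime pp po; exists m.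
    by have := leq_mul xp xp; have := leq_mul yp yp; nia.
  by exists x, y, 1, 0; rewrite -mE; lia.
elim/ltn_ind: m m_range mS => m IH /andP[m0 mp] mS.
have [m1|m1|m1] := ltngtP m 1; [by lia | | by move: mS; rewrite m1 mul1n].
have [|r /andP[r0 rm] rS] := sum4sq_descent pp _ mS; first by rewrite m1.
by apply: (IH r) => //; rewrite r0 (ltn_trans rm).
Qed.

Theorem lagrange_four_squares (n : nat) : sum4sq n.
Proof.
elim/ltn_ind: n => n IH; have [n1|n1] := leqP n 1.
  by case: n n1 {IH} => [|[|]] // _; [exists 0, 0, 0, 0 | exists 1, 0, 0, 0].
rewrite -(divnK (pdiv_dvd n)) PoszM; apply: sum4sqM; last exact/sum4sq_prime/pdiv_prime.
by apply: IH; rewrite ltn_Pdiv ?(ltnW n1) // prime_gt1 // pdiv_prime.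
Qed.

(** * Frames of every norm *)

(** The sum of the entries has the parity of [dot x x], so 2x lies in the even sublattice common to
    both neighbours. *)
Lemma lat_double s x : in_code3 x -> (2 %| dot x x)%Z -> lat s (2 *: x).
Proof.
move=> xc x_even; have sumE : (2 %| \sum_i x 0%R i)%Z.
  suff : (2 %| dot x x - \sum_i x 0%R i)%Z by lia.
  rewrite dotE -sumrB; apply: rpred_sum => i _.
  by have := dvd2_consecutive (x 0 i - 1); rewrite subrK mulrBl mul1r.
apply/and3P; split; last exact: in_code3Z.
  by apply/forallP => i; rewrite ![(2 *: x) _ _]mxE -mulrBr dvdz_mulr.
rewrite (eq_bigr (fun i => 2 * x 0 i)) => [|i _]; last by rewrite mxE.
rewrite -mulr_sumr ![(2 *: x) _ _]mxE mulrCA -mulrBr (@dvdz_mul2l 2 2) // rpredB //.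
by rewrite -mul2n PoszM -mulrA dvdz_mulr.
Qed.

Lemma double_frame_code k (X : 'M[int]_(24 + 24)) : (2 < k)%N ->
    (forall i, in_code3 (row i X)) -> X *m X^T = (6 * k)%:Z%:M ->
  exists C : {set 'rV['Z_(2 * k)]_48}, typeII C /\ extremal C.
Proof.
move=> k2 Xc XX; apply: (@frame_exists_code k (2 *: X)) => // [i|].
  have -> : row i (2 *: X) = 2 *: row i X by apply/rowP => j; rewrite !mxE.
  apply: lat_double => //; rewrite dot_rowr -row_mul XX !mxE eqxx; lia.
have -> : (2 *: X)^T = 2 *: X^T by apply/matrixP => i j; rewrite !mxE.
by rewrite -scalemxAl -scalemxAr scalerA XX scale_scalar_mx; congr (_%:M); lia.
Qed.

Lemma block_code (P Q R S : 'M[int]_24) :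
    red3 Q = red3 P *m paley3 -> red3 S = red3 R *m paley3 ->
  forall i, in_code3 (row i (block_mx P Q R S)).
Proof.
have redr (Y : 'M[int]_24) a : red3 (row a Y) = row a (red3 Y) by exact: map_row.
by move=> PQ RS i; case: (split_ordP i) => a ->; rewrite ?rowKu ?rowKd row_row_mx in_code3E !redr -row_mul ?PQ ?RS.
Qed.

Theorem code_5 : exists C : {set 'rV['Z_(2 * 5)]_48}, typeII C /\ extremal C.
Proof.
have ten12 : red3 ten2 = red3 ten1 *m paley3.
  have -> : red3 ten1 *m paley3 = red3 (ten1 *m paley) by rewrite /red3 map_mxM.
  by apply/eqP/red3_eqP => i j; have := ten_code i j; rewrite [X in (_ %| X)%Z]mxE [X in _ + X]mxE.
apply: (@double_frame_code 5 (block_mx ten1 ten2 ten2 ten1)) => //.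
  by apply: block_code => //; rewrite ten12 -mulmxA paley3_sqr mulmx1.
rewrite tr_block_mx mulmx_block ten_norm ten_orth [ten2 *m ten1^T + _]addrC ten_orth addrC ten_norm.
by rewrite -scalar_mx_block.
Qed.

(** The cross terms cancel by anticommutation, as in the norm of a quaternion. *)
Lemma quat_comb_mul_tr (d e f : int) : let Q := d *: quat1 + e *: quat2 + f *: quat3 in
  Q *m Q^T = (d ^+ 2 + e ^+ 2 + f ^+ 2)%:M.
Proof.
move=> Q; have -> : Q^T = d *: quat1^T + e *: quat2^T + f *: quat3^T.
  by apply/matrixP => i j; rewrite !(mxE, linearD).
rewrite /Q !mulmxDl !mulmxDr -!scalemxAl -!scalemxAr; have [-> -> ->] := quat_norm.
have [-> -> ->] := quat_anti.
move: (quat2 *m quat1^T) (quat3 *m quat1^T) (quat3 *m quat2^T) => U V W.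
by apply/matrixP => i j; rewrite !mxE; case: (i == j); ring.
Qed.

Theorem code_of_four_squares (k : nat) (a b c d e f : int) : (2 < k)%N -> (3 %| b - c)%Z ->
    (6 * k)%:Z = 9 * (a ^+ 2 + d ^+ 2 + e ^+ 2 + f ^+ 2) + 23 * c ^+ 2 + b ^+ 2 ->
  exists C : {set 'rV['Z_(2 * k)]_48}, typeII C /\ extremal C.
Proof.
move=> k2 bc kE.
pose Q := d *: quat1 + e *: quat2 + f *: quat3.
have QT : Q^T = - Q.
  have [t1 t2 t3] := quat_tr; apply/matrixP => i j.
  move/matrixP/(_ i j): t1; move/matrixP/(_ i j): t2; move/matrixP/(_ i j): t3.
  rewrite /Q !mxE => -> -> ->; ring.
have QQ : Q *m Q = - (d ^+ 2 + e ^+ 2 + f ^+ 2)%:M.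
  by apply: oppr_inj; rewrite -mulmxN -QT quat_comb_mul_tr opprK.
have MQ : paley *m Q = Q *m paley.
  have [c1 c2 c3] := quat_paley.
  by rewrite /Q !mulmxDr !mulmxDl -!scalemxAl -!scalemxAr c1 c2 c3.
pose alpha := (3 * a)%:M + c *: paley; pose beta := b%:M + 3 *: Q.
have alphaT : alpha^T = (3 * a)%:M + (- c) *: paley.
  move/matrixP: paley_tr => t; apply/matrixP => i j; move: (t i j).
  by rewrite !mxE eq_sym => ->; rewrite mulrN mulNr.
have betaT : beta^T = b%:M + (-3) *: Q.
  move/matrixP: QT => t; apply/matrixP => i j; move: (t i j).
  by rewrite !mxE eq_sym => ->; rewrite mulrN mulNr.
have lin_mul (s t s' t' : int) (Z Z' : 'M[int]_24) : (s%:M + t *: Z) *m (s'%:M + t' *: Z') =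
    (s * s')%:M + (s * t') *: Z' + (t * s') *: Z + (t * t') *: (Z *m Z').
  rewrite mulmxDl !mulmxDr !mul_scalar_mx !mul_mx_scalar -scalemxAl -scalemxAr !scalerA scale_scalar_mx.
  by rewrite !addrA [s' * t]mulrC.
have norm (s t n : int) Z : Z *m Z = - n%:M -> (s%:M + t *: Z) *m (s%:M + (- t) *: Z) = (s ^+ 2 + n * t ^+ 2)%:M /\
    (s%:M + (- t) *: Z) *m (s%:M + t *: Z) = (s ^+ 2 + n * t ^+ 2)%:M :> 'M_24.
  by move=> ZZ; rewrite !lin_mul ZZ; split; apply/matrixP => i j; rewrite !mxE; case: (i == j); ring.
have [aaT aTa] := norm (3 * a) c _ _ paley_sqr; have [bbT bTb] := norm b 3 _ _ QQ.
have ab : alpha *m beta = beta *m alpha.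
  by rewrite !lin_mul MQ; apply/matrixP => i j; rewrite !mxE; case: (i == j); ring.
have aTbT : alpha^T *m beta^T = beta^T *m alpha^T by rewrite -!trmx_mul ab.
apply: (@double_frame_code k (block_mx alpha beta (- beta^T) alpha^T)) => //.
  have redP : red3 paley = paley3 by [].
  have red_scal (s t : int) (Z : 'M[int]_24) : red3 (s%:M + t *: Z) = (s%:~R)%:M + t%:~R *: red3 Z.
    by rewrite /red3 map_mxD map_scalar_mx map_mxZ.
  have red_b : b%:~R = c%:~R :> 'F_3 by apply/eqP; rewrite -subr_eq0 -intrB intr_F3_eq0.
  have red_a : (3 * a)%:~R = 0 :> 'F_3 by apply/eqP; rewrite intr_F3_eq0 dvdz_mulr.
  have red_3 : 3%:~R = 0 :> 'F_3 by apply/eqP; rewrite intr_F3_eq0.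
  apply: block_code.
    rewrite !red_scal red_a red_3 red_b raddf0 scale0r add0r addr0 redP -scalemxAl paley3_sqr.
    by rewrite scale_scalar_mx mulr1.
  have -> : red3 (- beta^T) = - red3 beta^T by rewrite /red3 map_mxN.
  have red_m3 : (-3)%:~R = 0 :> 'F_3 by apply/eqP; rewrite intr_F3_eq0.
  rewrite alphaT betaT !red_scal red_a red_m3 red_b raddf0 scale0r add0r addr0 redP mulNmx mul_scalar_mx.
  by rewrite -scaleNr mulrNz.
have trN (Z : 'M[int]_24) : (- Z)^T = - Z^T by apply/matrixP => i j; rewrite !mxE.
(* The off-diagonal blocks vanish because [alpha] and [beta] commute. *)
rewrite tr_block_mx mulmx_block trN !trmxK !mulmxN !mulNmx opprK ab addNr aTbT addNr [beta^T *m beta + _]addrC.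
rewrite alphaT betaT aaT bbT aTa bTb -!raddfD /= -scalar_mx_block; congr (_%:M); rewrite kE; ring.
Qed.

Theorem code_ge3 (k : nat) : (2 < k)%N ->
  exists C : {set 'rV['Z_(2 * k)]_48}, typeII C /\ extremal C.
Proof.
move=> k2; have [->|k5] := eqVneq k 5%N; first exact: code_5.
have [q [kq|[kq|kq]]] : exists q, k = (3 * q)%N \/ k = (3 * q + 1)%N \/ k = (3 * q + 2)%N.
  by exists (k %/ 3)%N; lia.
- have [a [d [e [f E]]]] := lagrange_four_squares (2 * q).
  by apply: (@code_of_four_squares k a 0 0 d e f) => //; rewrite kq; lia.
(* Here 6k = 9(2q - 2) + 23 + 1, with q at least 1. *)
- have [a [d [e [f E]]]] := lagrange_four_squares (2 * q - 2).
  by apply: (@code_of_four_squares k a 1 1 d e f) => //; lia.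
(* Here 6k = 9(2q - 3) + 23 + 16; q is at least 2 because k = 2 and k = 5 are excluded. *)
- have [a [d [e [f E]]]] := lagrange_four_squares (2 * q - 3).
  by apply: (@code_of_four_squares k a 4 1 d e f) => //; lia.
Qed.

(** * The binary code *)

(* First row of a circulant matrix [R] for which [[I | R]] generates the extended quadratic residue code of length 48. *)
Definition circ_bits : seq bool := map (eq_op 1%N)
  [:: 0; 0; 0; 0; 0; 1; 1; 1; 0; 1; 1; 0; 1; 1; 0; 1; 0; 1; 1; 1; 1; 1; 1; 1]%N.
Definition circ_fun (i j : nat) : bool := nth false circ_bits ((j + 24 - i) %% 24).
Definition circ_tab := Eval vm_compute in tab24 (fun i j => (circ_fun i j : nat)%:Z).
Definition circ := mxtab circ_tab.
Definition circ2 : 'M['F_2]_24 := map_mx intr circ.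

Definition bool_val (b : bool) : 'F_2 := (b : nat)%:R.
Lemma bool_valD : {morph bool_val : x y / x (+) y >-> x + y}.
Proof. by case; case; apply/eqP. Qed.

Lemma bool_nzE x : x = (bool_val x != 0).
Proof. by case: x. Qed.

Lemma F2P (x : 'F_2) : x = 0 \/ x = 1.
Proof. by case: x => [[|[|]]] // i; [left | right]; apply/eqP. Qed.

Lemma intr_F2_eq0 (z : int) : ((z%:~R : 'F_2) == 0) = (2 %| z)%Z.
Proof. by rewrite (@dvdz_pcharf 'F_2 2) // pchar_Fp. Qed.

Lemma circE i j : circ i j = (circ_fun i j : nat)%:Z.
Proof.
have chk : tab_all2 (fun i j a _ => a == (circ_fun i j : nat)%:Z) circ_tab circ_tab by tab_check.
exact/eqP/(tab_all2P i j chk).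
Qed.

Lemma circ2E i j : circ2 i j = bool_val (circ_fun i j).
Proof. by rewrite mxE circE. Qed.

Lemma circ_gram i j : (2 %| (circ *m circ^T)%R i j + (i == j)%:R)%Z /\ (4 %| (circ *m circ^T)%R i i + 1)%Z.
Proof.
have chk : all is_tab24 [:: circ_tab; circ_tab; circ_tab; circ_tab] &&
    tab_all2 (fun i j a _ => (2 %| a + (i == j)%:R)%Z && ((i == j) ==> (4 %| a + 1)%Z))
      (mulT circ_tab circ_tab) (mulT circ_tab circ_tab) by tab_check.
have gram a b := mxtab_mul_trP a b chk; clear chk.
by have /andP[-> _] := gram i j; have /andP[_ /implyP/(_ (eqxx _)) ->] := gram i i.
Qed.

Lemma circ2_mul_tr : circ2 *m circ2^T = - 1%:M.
Proof.
rewrite /circ2 map_trmx -map_mxM; apply/matrixP => i j; rewrite [LHS]mxE.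
have := (circ_gram i j).1; rewrite -intr_F2_eq0 intrD addr_eq0 => /eqP e; apply: etrans e _.
by rewrite !mxE; case: (i == j).
Qed.

Lemma circ_half_wt (M : 'M['F_2]_24) (g : nat -> nat -> bool) (u : 'rV['F_2]_24) :
    (forall i j, M i j = bool_val (g i j)) -> M *m M^T = - 1%:M ->
    search addb id 4 (map (fun i => [:: mkseq (g i) 24]) (iota 0 24)) (nseq 24 false) 7 ->
  u != 0 -> (wt u <= 4)%N -> (8 < wt u + wt (u *m M)%R)%N.
Proof.
move=> ME MM srch u0 u4.
have denM (i : 'I_24) : den bool_val false 24 (mkseq (g i) 24) = row i M.
  by apply/rowP => j; rewrite !mxE nth_mkseq // ME.
have := @search_mulmx _ _ _ _ _ false _ _ bool_valD bool_nzE M _ _ _ _ _ u _ _ _ srch.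
rewrite -(wt_count _ (perm_refl _)) => H.
have : (7 < wt (u *m M)%R + (wt u).-1)%N.
  apply: H => //.
  - move=> i; apply: contraTneq isT => /(congr1 (fun v => v *m M^T)).
    by rewrite mul0mx -row_mul MM => /rowP/(_ i); rewrite !mxE eqxx.
  - by move=> i c; case: (F2P c) => ->; rewrite ?eqxx // scale1r -denM map_f ?mem_seq1.
  - rewrite big1 => [|i]; last by rewrite mem_iota ltn_ord.
    by apply/rowP => j; rewrite !mxE nth_nseq if_same.
  - by rewrite u4 lt0n wt_eq0 u0.
by have : (0 < wt u)%N by [rewrite lt0n wt_eq0]; lia.
Qed.

(** One half of a word of weight at most 8 has weight at most 4. If it is the right one, the search
    runs on the transpose, which recovers u from u R. *)
Lemma circ_min_wt (u : 'rV['F_2]_24) : u != 0 -> (8 < wt u + wt (u *m circ2)%R)%N.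
Proof.
move=> u0; have circ_tr_mul : circ2^T *m circ2^T^T = - 1%:M.
  have : circ2 *m - circ2^T = 1%:M by rewrite mulmxN circ2_mul_tr opprK.
  by rewrite trmxK => /mulmx1C; rewrite mulNmx => /(congr1 -%R); rewrite opprK.
rewrite ltnNge; apply/negP => tot; have [u4|u4] := leqP (wt u) 4.
  suff : (8 < wt u + wt (u *m circ2)%R)%N by rewrite ltnNge tot.
  apply: (circ_half_wt circ2E circ2_mul_tr _ u0 u4); tab_check.
have v4 : (wt (u *m circ2) <= 4)%N.
  by rewrite -(leq_add2l (wt u)) (leq_trans tot) // (leq_add2r 4 4) ltnW.
have uK : u = - (u *m circ2 *m circ2^T) by rewrite -mulmxA circ2_mul_tr mulmxN mulmx1 opprK.
have v0 : u *m circ2 != 0 by apply: contraNneq u0 => v0; rewrite uK v0 mul0mx oppr0.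
suff : (8 < wt (u *m circ2)%R + wt (u *m circ2 *m circ2^T)%R)%N.
  rewrite ltnNge addnC (_ : wt (_ *m circ2^T) = wt u) ?tot // {2}uK.
  by apply: eq_bigr => i _; rewrite [in RHS]mxE oppr_eq0.
apply: (@circ_half_wt _ (fun i j => circ_fun j i) _ _ circ_tr_mul _ v0 v4); last tab_check.
by move=> i j; rewrite mxE circ2E.
Qed.

Definition red2 m n : 'M[int]_(m, n) -> 'M['F_2]_(m, n) := map_mx intr.
(** Construction A: the vectors reducing to codewords modulo 2, with scalar product [dot / 2]. *)
Definition lat2 (h : 'rV[int]_(24 + 24)) : bool := red2 (rsubmx h) == red2 (lsubmx h) *m circ2.

Lemma lat2_word h : lat2 h -> red2 h = row_mx (red2 (lsubmx h)) (red2 (lsubmx h) *m circ2).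
Proof. by move=> /eqP <-; rewrite -map_row_mx hsubmxK. Qed.

Lemma dot_red2 n (u v : 'rV[int]_n) : dot (red2 u) (red2 v) = (dot u v)%:~R.
Proof. by rewrite !dotE rmorph_sum; apply: eq_bigr => i _; rewrite !mxE rmorphM. Qed.

Lemma lat2_int h g : lat2 h -> lat2 g -> (2 %| dot h g)%Z.
Proof.
by move=> /lat2_word hc /lat2_word gc; rewrite -intr_F2_eq0 -dot_red2 hc gc dot_code_word ?circ2_mul_tr.
Qed.

Lemma red2_surj m n (y : 'M['F_2]_(m, n)) : exists u, y = red2 u.
Proof.
exists (\matrix_(i, j) (nat_of_ord (y i j))%:Z); apply/matrixP => i j; rewrite !mxE.
by rewrite -[RHS]/((nat_of_ord (y i j))%:R) natr_Zp.
Qed.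

Lemma lat2_gen y : lat2 (row_mx y (y *m circ)).
Proof. by rewrite /lat2 row_mxKl row_mxKr /red2 map_mxM. Qed.

Lemma lat2_dualP h : lat2 h <-> forall g, lat2 g -> (2 %| dot h g)%Z.
Proof.
split=> [hl g|dual]; first exact: lat2_int.
suff /(congr1 rsubmx) : red2 h = row_mx (lsubmx (red2 h)) (lsubmx (red2 h) *m circ2).
  by rewrite row_mxKr /lat2 /red2 map_rsubmx map_lsubmx => /eqP.
apply: (code_word_dual circ2_mul_tr) => y.
have [u ->] := red2_surj y; have -> : row_mx (red2 u) (red2 u *m circ2) = red2 (row_mx u (u *m circ)).
  by rewrite /red2 map_row_mx map_mxM.
by rewrite -/(red2 h) dot_red2; apply/eqP; rewrite intr_F2_eq0 dual // lat2_gen.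
Qed.

Lemma lat2D h g : lat2 h -> lat2 g -> lat2 (h + g).
Proof.
by move=> hl gl; apply/lat2_dualP => f fl; rewrite dotDl rpredD // lat2_int.
Qed.

(** A vector is a combination of rows of [I | R], of norm divisible by 4, plus twice an integer
    vector. Sums preserve this divisibility since products are even. *)
Lemma lat2_even h : lat2 h -> (4 %| dot h h)%Z.
Proof.
have dvdD u v : lat2 u -> lat2 v -> (4 %| dot u u)%Z -> (4 %| dot v v)%Z -> (4 %| dot (u + v) (u + v))%Z.
  move=> ul vl uu vv; have /dvdzP[q uv] := lat2_int ul vl.
  have -> : dot (u + v) (u + v) = dot u u + dot v v + 2 * dot u v.
    by rewrite dotDl ![dot _ (u + v)]dotC !dotDl [dot v u]dotC; ring.
  by rewrite uv; lia.
move=> /eqP hl; pose w := map_mx (divz^~ 2) (rsubmx h - lsubmx h *m circ).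
have wE : rsubmx h = lsubmx h *m circ + 2 *: w.
  rewrite -dvd_rowP ?subrKC // => i; rewrite -intr_F2_eq0 mxE [X in _ + X]mxE intrB subr_eq0.
  move/rowP/(_ i): hl; rewrite [LHS]mxE => ->; rewrite /red2 -map_mxM mxE; exact: eqxx.
have -> : h = row_mx (lsubmx h) (lsubmx h *m circ) + row_mx 0 (2 *: w).
  by rewrite add_row_mx addr0 -wE hsubmxK.
have l0 : lat2 (row_mx 0 (2 *: w)).
  rewrite /lat2 row_mxKl row_mxKr /red2 map_mx0 mul0mx; apply/eqP/rowP => i; rewrite !mxE.
  by apply/eqP; rewrite intr_F2_eq0 dvdz_mulr.
apply: (dvdD _ _) => //; first exact: lat2_gen; last first.
  rewrite /dot tr_row_mx mul_row_col mul0mx add0r.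
  by rewrite -/(dot _ _) dotZl dotC dotZl mulrA dvdz_mulr.
move: (lsubmx h) => y {h hl w wE l0}.
have -> : row_mx y (y *m circ) = \sum_i y 0 i *: row i (row_mx 1%:M circ).
  by rewrite -mulmx_sum_row mul_mx_row mulmx1.
pose K (c : 'rV[int]_(24 + 24)) := lat2 c && (4 %| dot c c)%Z.
suff : K (\sum_i y 0 i *: row i (row_mx 1%:M circ)) by case/andP.
apply: (big_ind K) => [|u v /andP[ul uu] /andP[vl vv]|i _].
- by rewrite /K /lat2 /dot mul0mx mxE !linear0 /red2 map_mx0 mul0mx eqxx.
- by rewrite /K lat2D // dvdD.
have gi : row i (row_mx 1%:M circ) = row_mx (row i 1%:M) (row i 1%:M *m circ).
  by rewrite row_row_mx -row_mul mul1mx.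
have li : lat2 (y 0 i *: row i (row_mx 1%:M circ)).
  by rewrite gi scale_row_mx scalemxAl; exact: lat2_gen.
rewrite /K li /= dotZl dotC dotZl mulrA dvdz_mull //.
have -> : dot (row i (row_mx 1%:M circ)) (row i (row_mx 1%:M circ)) = (circ *m circ^T) i i + 1.
  rewrite dot_rowr -row_mul [row _ _ _ _]mxE tr_row_mx mul_row_col trmx1 mulmx1 mxE addrC.
  by rewrite [X in _ + X]mxE eqxx.
exact: (circ_gram i i).2.
Qed.

Theorem code_1 : exists C : {set 'rV['Z_(2 * 1)]_48}, typeII C /\ extremal C.
Proof.
pose F : 'M[int]_(24 + 24) := 2%:M.
have rowF i : row i F = 2 *: delta_mx 0 i 
  by apply/rowP => j; rewrite !mxE eqxx andTb [j == i]eq_sym mulr_natr.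
have dotF h i : dot h (row i F) = 2 * h 0 i by rewrite rowF dotC dotZl dotC dot_delta.
have LF i : lat2 (row i F) by apply/lat2_dualP => g _; rewrite dotC dotF dvdz_mulr.
have FF : F *m F^T = (2 * (2 * 1))%:Z%:M by rewrite /F tr_scalar_mx -scalar_mxM.
exists (@frame_code 1 (24 + 24) lat2 F); split.
  exact: (@frame_code_typeII 2 1 _ _ _ isT isT lat2_dualP lat2_even LF FF).
apply: (@frame_code_min 2 1 _ _ _ isT isT lat2_dualP LF FF).
  (* The bound leaves entries 0, 1 and -1, so the norm is the weight of the codeword: above 8 and
     divisible by 4. *)
  move=> h hl h0 bound; have h_small i : h 0 i * h 0 i = (red2 h 0 i != 0).
    have := bound i; rewrite dotF [red2 h 0 i]mxE intr_F2_eq0; move: (h 0 i) => x.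
    by move=> x1; have [->|[->|->]] : x = 0 \/ x = 1 \/ x = -1 by lia.
  have hh : dot h h = wt (red2 h).
    by rewrite dotE /wt (big_morph Posz PoszD (erefl 0%Z)); apply: eq_bigr => i _; rewrite h_small.
  have : (8 < wt (red2 h))%N.
    rewrite (lat2_word hl) wt_row_mx circ_min_wt //; apply: contraNneq h0 => l0.
    have := dot_gt0; move=> /(_ _ h); rewrite hh (lat2_word hl) l0 mul0mx row_mx0.
    by case: eqP => // _ /(_ isT); rewrite (eqP (_ : wt 0 == 0%N)) // wt_eq0.
  by have := lat2_even hl; rewrite hh; lia.
(* The difference of two generators, of norm 2 + 15 + 15 - 2 * 10 = 12. *)
pose y : 'rV[int]_24 := delta_mx 0 0 - delta_mx 0 1; pose h := row_mx y (y *m circ).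
have gram : all is_tab24 [:: circ_tab; circ_tab; circ_tab; circ_tab] &&
    tab_all2 (fun i j a _ => (i < 2)%N && (j < 2)%N ==> (a == if i == j then 15 else 10))
      (mulT circ_tab circ_tab) (mulT circ_tab circ_tab) by tab_check.
have gramE (a b : 'I_24) : (a < 2)%N -> (b < 2)%N -> (circ *m circ^T) a b = if a == b then 15 else 10.
  by move=> a2 b2; have := mxtab_mul_trP a b gram; clear gram; rewrite a2 b2 => /eqP.
clear gram; exists h; first exact: lat2_gen.
split; last by exists i0; rewrite dotF row_mxEl !mxE.
rewrite /dot tr_row_mx mul_row_col mxE -!/(dot _ _).
have yc : y *m circ = row 0 circ - row 1 circ by rewrite mulmxBl -!rowE.
rewrite yc !dotBl ![dot (row _ _) _]dotC !dotBl.
have dotr a b : dot (row a circ) (row b circ) = (circ *m circ^T) a b by rewrite dot_rowr -row_mul mxE.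
by rewrite !dotr !gramE //= ![dot (delta_mx _ _) _]dotC !dot_delta !mxE.
Qed.

Local Close Scope ring_scope.

Theorem theorem5p5 : forall k : nat, (0 < k)%N ->
  exists C : {set 'rV['Z_(2 * k)]_48}, typeII C /\ extremal C.
Proof.
by move=> [|[|[|k]]] // _; [exact: code_1 | exact: code_2 | exact: code_ge3].
Qed.
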